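(* A finite-dimensional real Lie algebra $\mathfrak g$ is $(3,4)$-trivial if and only if $\mathfrak g$ is solvable and for any codimension one ideal $\mathfrak k$ of $\mathfrak g$ containing the derived algebra $\mathfrak g'=[\mathfrak g,\mathfrak g]$ one has $H^i(\mathfrak k)^{\mathfrak g}=0$ for $i=2,3,4$.
   Context: $H^k(\mathfrak g)$ denotes Lie algebra cohomology with trivial real coefficients and $b_k(\mathfrak g)=\dim H^k(\mathfrak g)$. A Lie algebra is $(3,4)$-trivial if $b_3(\mathfrak g)=0=b_4(\mathfrak g)$. For an ideal $\mathfrak k$ of $\mathfrak g$ containing $\mathfrak g'$, $\mathfrak g$ acts on $H^q(\mathfrak k)$ by $A\cdot[\alpha]=[A\lrcorner\, d\alpha]$, where $\alpha$ is extended to a form on $\mathfrak g$, $d$ is the differential of $\mathfrak g$ and the result is restricted to $\mathfrak k$ (up to sign convention this is the action induced by the adjoint action of $\mathfrak g$ on $\mathfrak k$); $\mathfrak k$ acts trivially. $H^q(\mathfrak k)^{\mathfrak g}=\{b\in H^q(\mathfrak k): A\cdot b=0 \text{ for all } A\in\mathfrak g\}$ is the $\mathfrak g$-invariant part. *)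

(* Defs.v *)
From HB Require Import structures.
From mathcomp Require Import all_boot all_order all_algebra.
From mathcomp Require Import all_classical all_reals.
From mathcomp Require Import zify ring.

Set Implicit Arguments.
Unset Strict Implicit.
Unset Printing Implicit Defensive.

Import GRing.Theory.
Local Open Scope ring_scope.
Local Open Scope classical_set_scope.

Definition vquot (F : fieldType) (V : vectType F) (U : {vspace V}) : Type :=
  Quotient.quot U.

Section VQuot.
Variables (F : fieldType) (V : vectType F) (U : {vspace V}).
Local Notation Q := (vquot U).

HB.instance Definition _ := Choice.on Q.
HB.instance Definition _ := GRing.Zmodule.on Q.

Definition vproj (v : V) : Q := \pi_(Quotient.quot U)%qT v.
Definition vrepr (q : Q) : V := repr (q : Quotient.quot U).

Lemma vreprK q : vproj (vrepr q) = q. Proof. exact: reprK. Qed.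

Lemma vproj_eq u v : (vproj u == vproj v) = (u - v \in U).
Proof. by rewrite Quotient.idealrBE. Qed.

Lemma vproj_eq0 v : (vproj v == 0) = (v \in U).
Proof.
have <- : vproj 0 = 0 by rewrite /vproj; exact: (raddf0 \pi_(Quotient.quot U)%qT).
by rewrite vproj_eq subr0.
Qed.

Lemma vprojD : {morph vproj : u v / u + v}.
Proof. exact: (raddfD \pi_(Quotient.quot U)%qT). Qed.

Definition vquot_scale (a : F) (q : Q) : Q := vproj (a *: vrepr q).

Lemma vprojZ a v : vproj (a *: v) = vquot_scale a (vproj v).
Proof.
apply/eqP; rewrite vproj_eq -scalerBr rpredZ //.
by rewrite -vproj_eq vreprK.
Qed.

Fact vquot_scaleA a b q :
  vquot_scale a (vquot_scale b q) = vquot_scale (a * b) q.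
Proof. by rewrite -(vreprK q) -!vprojZ scalerA. Qed.

Fact vquot_scale1 q : vquot_scale 1 q = q.
Proof. by rewrite -(vreprK q) -!vprojZ scale1r. Qed.

Fact vquot_scaleDr : right_distributive vquot_scale +%R.
Proof.
move=> a p q; rewrite -(vreprK p) -(vreprK q) -vprojD -!vprojZ -vprojD.
by rewrite scalerDr.
Qed.

Fact vquot_scaleDl q : {morph vquot_scale^~ q : a b / a + b}.
Proof.
by move=> a b /=; rewrite -(vreprK q) -!vprojZ -vprojD scalerDl.
Qed.

HB.instance Definition _ := GRing.Zmodule_isLmodule.Build F Q
  vquot_scaleA vquot_scale1 vquot_scaleDr vquot_scaleDl.

Fact vproj_is_linear : linear vproj.
Proof. by move=> a u v; rewrite vprojD vprojZ. Qed.

HB.instance Definition _ := GRing.isLinear.Build F V Q _ vproj vproj_is_linear.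

End VQuot.

Section FinDim.
Variables (F : fieldType) (V : lmodType F) (W : vectType F).
Variables (phi : {linear V -> W}) (phi_inj : injective phi).

Lemma fin_dim_inj : {n : nat & Vector.axiom n V}.
Proof.
pose P d := `[< exists U : {vspace W},
  \dim U = d /\ forall w, w \in U -> exists v, phi v = w >].
have P0 : exists d, P d.
  exists 0%N; apply/asboolP; exists 0%VS; rewrite dimv0; split=> // w.
  by rewrite memv0 => /eqP->; exists 0; rewrite linear0.
have Pm d : P d -> (d <= \dim {:W})%N.
  by move=> /asboolP[U [<- _]]; exact/dimvS/subvf.
case: (ex_maxnP P0 Pm) => d /asboolP/cid[U [dU UP]] dmax.
have phiU v : phi v \in U.
  apply: contraT => vU.
  suff : P d.+1 by move=> /dmax; rewrite ltnn.
  apply/asboolP; exists (U + <[phi v]>)%VS; split.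
    rewrite dimv_disjoint_sum ?dim_vline.
      case: eqP => [v0|_]; last by rewrite dU addn1.
      by rewrite v0 mem0v in vU.
    apply/eqP; rewrite -subv0; apply/subvP=> w; rewrite memv_cap => /andP[wU].
    move=> /vlineP[a wE]; rewrite memv0; apply/eqP; move: wU; rewrite wE.
    case: (eqVneq a 0) => [->|a0]; first by rewrite scale0r.
    by rewrite rpredZeq (negbTE a0) /= (negbTE vU).
  move=> w /memv_addP[u uU [t /vlineP[a ->] ->]].
  by have [v' <-] := UP _ uU; exists (v' + a *: v); rewrite linearD linearZ.
pose f (v : V) : 'rV[F]_(\dim U) := \row_i coord (vbasis U) i (phi v).
exists (\dim U); exists f.
  by move=> a u v; apply/rowP=> i; rewrite !mxE linearP linearP.
pose s (r : 'rV[F]_(\dim U)) : W := \sum_i r 0 i *: (vbasis U)`_i.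
have sU r : s r \in U.
  by apply: rpred_sum => i _; rewrite rpredZ // vbasis_mem // mem_nth ?size_tuple.
pose g r := sval (cid (UP _ (sU r))).
have gP r : phi (g r) = s r by rewrite /g; case: cid.
exists g => [v|r].
  apply: phi_inj; rewrite gP /s [RHS](coord_vbasis (phiU v)).
  by apply: eq_bigr => i _; rewrite mxE.
apply/rowP=> i; rewrite mxE gP /s coord_sum_free //.
exact: (basis_free (vbasisP U)).
Qed.

End FinDim.

Section VQuotVect.
Variables (F : fieldType) (V : vectType F) (U : {vspace V}).

Let cpl (q : vquot U) : V := vrepr q - projv U (vrepr q).

Let cplE v : cpl (vproj U v) = v - projv U v.
Proof.
have : vrepr (vproj U v) - v \in U by rewrite -vproj_eq vreprK.
move=> /projv_id; rewrite linearB /= => wE; apply/eqP; rewrite -subr_eq0 /cpl.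
by rewrite opprD opprK addrACA -wE addrACA subrr addNr addr0.
Qed.

Let cpl_linear : linear cpl.
Proof.
move=> a p q; rewrite -(vreprK p) -(vreprK q) -linearP !cplE /=.
by rewrite linearP /= scalerBr opprD addrACA.
Qed.

Let cpl_inj : injective cpl.
Proof.
move=> p q /eqP; rewrite -(vreprK p) -(vreprK q) !cplE -subr_eq0.
move: (vrepr p) (vrepr q) => u v; rewrite opprD opprK addrACA => H.
apply/eqP; rewrite vproj_eq.
suff -> : u - v = projv U (u - v) by exact: memv_proj.
by apply/eqP; rewrite -subr_eq0 linearB /= opprB [projv U v - _]addrC.
Qed.

HB.instance Definition _ := GRing.isLinear.Build F (vquot U) V _ cpl cpl_linear.

Fact vquot_vect_iso : {n : nat & Vector.axiom n (vquot U)}.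
Proof. exact: (fin_dim_inj cpl_inj). Qed.

HB.instance Definition _ := Lmodule_hasFinDim.Build F (vquot U)
  (projT2 vquot_vect_iso).

End VQuotVect.

Section Upd.
Variable T : Type.

Definition upd k (x : 'I_k -> T) (i : 'I_k) (v : T) : 'I_k -> T :=
  fun j => if j == i then v else x j.

Definition fcons k (v : T) (x : 'I_k -> T) : 'I_k.+1 -> T :=
  fun i => if unlift ord0 i is Some j then x j else v.

Lemma upd_same k (x : 'I_k -> T) i v : upd x i v i = v.
Proof. by rewrite /upd eqxx. Qed.

Lemma upd_diff k (x : 'I_k -> T) i v j : j != i -> upd x i v j = x j.
Proof. by rewrite /upd => /negbTE->. Qed.

Lemma upd_id k (x : 'I_k -> T) i : upd x i (x i) = x.
Proof. by apply/funext => j; rewrite /upd; case: eqP => [->|]. Qed.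

Lemma upd_upd k (x : 'I_k -> T) i u v : upd (upd x i u) i v = upd x i v.
Proof. by apply/funext => j; rewrite /upd; case: eqP. Qed.

Lemma updC k (x : 'I_k -> T) i j u v : i != j ->
  upd (upd x i u) j v = upd (upd x j v) i u.
Proof.
move=> ij; apply/funext => h; rewrite /upd.
by case: (eqVneq h j) => // ->; rewrite eq_sym (negbTE ij).
Qed.

Lemma fcons0 k v (x : 'I_k -> T) : fcons v x ord0 = v.
Proof. by rewrite /fcons unlift_none. Qed.

Lemma fconsS k v (x : 'I_k -> T) i : fcons v x (lift ord0 i) = x i.
Proof. by rewrite /fcons liftK. Qed.

Lemma fcons_eta k (x : 'I_k.+1 -> T) : x = fcons (x ord0) (x \o lift ord0).
Proof.
by apply/funext => i; case: (unliftP ord0 i) => [j|] ->; rewrite ?fconsS ?fcons0.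
Qed.

Lemma upd_fcons0 k v (x : 'I_k -> T) w : upd (fcons v x) ord0 w = fcons w x.
Proof.
by apply/funext => i; case: (unliftP ord0 i) => [j|] ->;
  rewrite ?upd_same ?upd_diff ?fconsS ?fcons0.
Qed.

Lemma upd_fconsS k v (x : 'I_k -> T) i w :
  upd (fcons v x) (lift ord0 i) w = fcons v (upd x i w).
Proof.
apply/funext => h; case: (unliftP ord0 h) => [j|] ->; rewrite ?fconsS ?fcons0.
  by rewrite /upd (inj_eq lift_inj) fconsS.
by rewrite upd_diff ?fcons0.
Qed.

Lemma fcons_lift0 k v (x : 'I_k -> T) : fcons v x \o lift ord0 = x.
Proof. by apply/funext => i /=; rewrite fconsS. Qed.

Lemma fcons_lift k v (x : 'I_k.+1 -> T) (j : 'I_k.+1) :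
  fcons v x \o lift (lift ord0 j) = fcons v (x \o lift j).
Proof.
apply/funext => h; case: (unliftP ord0 h) => [i|] -> /=.
  have -> : lift (lift ord0 j) (lift ord0 i) = lift ord0 (lift j i).
    by apply/val_inj; rewrite /= bumpS.
  by rewrite !fconsS.
have -> : lift (lift ord0 j) ord0 = ord0 by exact/val_inj.
by rewrite !fcons0.
Qed.

End Upd.

Lemma comp_upd (T U : Type) (f : T -> U) k (x : 'I_k -> T) i v :
  f \o upd x i v = upd (f \o x) i (f v).
Proof. by apply/funext => j; rewrite /upd /=; case: eqP. Qed.

Lemma comp_fcons (T U : Type) (f : T -> U) k (x : 'I_k -> T) v :
  f \o fcons v x = fcons (f v) (f \o x).
Proof. by apply/funext => j; rewrite /fcons /=; case: unlift. Qed.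

Section AltForm.
Variables (F : fieldType) (L : vectType F).

Definition multilinear k (f : ('I_k -> L) -> F^o) : Prop :=
  forall (x : 'I_k -> L) (i : 'I_k), linear (fun v => f (upd x i v)).

Definition alternating k (f : ('I_k -> L) -> F^o) : Prop :=
  forall (x : 'I_k -> L) (i j : 'I_k), i != j -> x i = x j -> f x = 0.

Definition is_altform k : {pred ('I_k -> L) -> F^o} :=
  fun f => `[< multilinear f /\ alternating f >].

Lemma is_altformP k (f : ('I_k -> L) -> F^o) :
  reflect (multilinear f /\ alternating f) (f \in @is_altform k).
Proof. exact: asboolP. Qed.

Fact is_altform_submod k : submod_closed (@is_altform k).
Proof.
split=> [|a f g /is_altformP[fl fa] /is_altformP[gl ga]]; apply/is_altformP.
  by split=> // x i a u v /=; rewrite scaler0 addr0.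
have E y : (a *: f + g) y = a *: f y + g y by [].
split=> [x i b u v|x i j ij xij]; rewrite !E; last first.
  by rewrite (fa _ i j) ?(ga _ i j) // scaler0 addr0.
by rewrite fl gl !scalerDr addrACA !scalerA [a * b]mulrC.
Qed.

HB.instance Definition _ k := GRing.isSubmodClosed.Build F _ (@is_altform k)
  (@is_altform_submod k).

Record altform k := AltForm {
  altfun :> ('I_k -> L) -> F^o;
  altfunP : altfun \in @is_altform k }.

HB.instance Definition _ k := [isSub for @altfun k].
HB.instance Definition _ k := [Choice of altform k by <:].
HB.instance Definition _ k := [SubChoice_isSubLmodule of altform k by <:].

Lemma altfun_ml k (f : altform k) : multilinear f.
Proof. by have /is_altformP[] := altfunP f. Qed.

Lemma altfun_alt k (f : altform k) : alternating f.
Proof. by have /is_altformP[] := altfunP f. Qed.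

Lemma altform_ext k (f g : altform k) : (forall x, f x = g x) -> f = g.
Proof. by move=> fg; apply/val_inj/funext. Qed.

Lemma altformD k (f g : altform k) x : (f + g) x = f x + g x.
Proof. by []. Qed.
Lemma altformN k (f : altform k) x : (- f) x = - f x.
Proof. by []. Qed.
Lemma altformZ k a (f : altform k) x : (a *: f) x = a *: f x.
Proof. by []. Qed.
Lemma altform0 k x : (0 : altform k) x = 0.
Proof. by []. Qed.

Section Coordinates.
Variable k : nat.
Let n := \dim {:L}.
Let e := vbasis {:L}.

Definition altcoord (f : altform k) : {ffun {ffun 'I_k -> 'I_n} -> F^o} :=
  [ffun s : {ffun 'I_k -> 'I_n} => f (fun i => e`_(s i))].

Fact altcoord_linear : linear altcoord.
Proof. by move=> a f g; apply/ffunP => s; rewrite !ffunE. Qed.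

HB.instance Definition _ := GRing.isLinear.Build F (altform k)
  {ffun {ffun 'I_k -> 'I_n} -> F^o} _ altcoord altcoord_linear.

Lemma altcoord_inj : injective altcoord.
Proof.
suff: forall h, altcoord h = 0 -> h = 0.
  move=> H f g /eqP; rewrite -subr_eq0 -linearB => /eqP/H/eqP.
  by rewrite subr_eq0 => /eqP.
move=> h h0; apply: altform_ext => z.
have H m : (m <= k)%N -> forall x : 'I_k -> L,
    (forall i : 'I_k, (m <= i)%N -> exists s : 'I_n, x i = e`_s) -> h x = 0.
  elim: m => [_ x xe|m IH mk x xe].
    have /choice[s sx] : forall i, exists s : 'I_n, x i = e`_s by move=> i; exact: xe.
    have -> : x = fun i => e`_([ffun i => s i] i) by apply/funext => i; rewrite ffunE.
    by move/ffunP/(_ [ffun i => s i]) : h0; rewrite !ffunE.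
  pose i0 := Ordinal mk.
  pose hl := GRing.isLinear.Build F L F^o _ _ (altfun_ml h x i0).
  pose hm : {linear L -> F^o} := HB.pack (fun v => h (upd x i0 v)) hl.
  have -> : h x = hm (x i0) by rewrite /= upd_id.
  rewrite (coord_vbasis (memvf (x i0))) linear_sum big1 // => s _.
  rewrite linearZ /= IH ?scaler0 // 1?ltnW // => i; rewrite leq_eqVlt => /predU1P[mi|mi].
    by exists s; rewrite (_ : i = i0) ?upd_same//; exact/val_inj.
  have [t xt] := xe i mi; exists t; rewrite upd_diff //.
  by apply: contraTneq mi => ->; rewrite ltnn.
by apply: (H k) => // i; rewrite leqNgt ltn_ord.
Qed.

Fact altform_vect_iso : {m : nat & Vector.axiom m (altform k)}.
Proof. exact: (fin_dim_inj altcoord_inj). Qed.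

HB.instance Definition _ := Lmodule_hasFinDim.Build F (altform k)
  (projT2 altform_vect_iso).

End Coordinates.

End AltForm.

Section AltTheory.
Variables (F : fieldType) (L : vectType F).

Lemma alt_swap k (f : ('I_k -> L) -> F^o) x i j u v :
  multilinear f -> alternating f -> i != j ->
  f (upd (upd x i u) j v) = - f (upd (upd x i v) j u).
Proof.
move=> fl fa ij; pose G a b := f (upd (upd x i a) j b).
have GDr a b c : G a (b + c) = G a b + G a c.
  by have := fl (upd x i a) j 1 b c; rewrite /= !scale1r.
have GDl a b c : G (a + b) c = G a c + G b c.
  rewrite /G !(updC x _ _ ij).
  by have := fl (upd x j c) i 1 a b; rewrite /= !scale1r.
have G0 w : G w w = 0 by apply: (fa _ i j ij); rewrite upd_same upd_diff ?upd_same.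
apply/eqP; rewrite -/(G u v) -/(G v u) -addr_eq0; apply/eqP.
by have := G0 (u + v); rewrite GDl !GDr !G0 add0r addr0.
Qed.

(* Moving the first argument to position j costs (-1)^j. *)
Lemma alt_move k (f : ('I_k.+1 -> L) -> F^o) (y : 'I_k.+1 -> L) (j : 'I_k.+1) v :
  multilinear f -> alternating f ->
  f (fcons v (y \o lift j)) = (-1) ^+ j *: f (upd y j v).
Proof.
move=> fl fa; case: j => j; elim: j y => [|j IH] y jk.
  have -> : Ordinal jk = ord0 by exact/val_inj.
  by rewrite expr0 scale1r [in RHS](fcons_eta y) upd_fcons0.
pose j0 := Ordinal (ltnW jk); pose j1 := Ordinal jk.
have j01 : j0 != j1 by rewrite -val_eqE /= ltn_eqF.
pose y' := upd y j1 (y j0).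
have -> : y \o lift j1 = y' \o lift j0.
  apply/funext => i; rewrite /y' /upd /= -val_eqE /=.
  case: ifP => [/eqP ij|/eqP ij]; congr y; apply/val_inj; move: ij; rewrite /= /bump.
    by case: (leqP j.+1 i); case: (leqP j i) => /=; lia.
  by case: (leqP j.+1 i); case: (leqP j i) => /=; lia.
rewrite IH exprS mulN1r scaleNr -scalerN; congr (_ *: _).
by rewrite /y' alt_swap 1?eq_sym // (updC _ _ _ (_ : j1 != j0)) 1?eq_sym // upd_id.
Qed.

End AltTheory.

HB.mixin Record Vector_isLie (F : fieldType) (L : Type) of Vector F L := {
  lie : L -> L -> L;
  lie_linearl : forall y : L, linear (lie^~ y);
  lie_linearr : forall x : L, linear (lie x);
  liexx : forall x : L, lie x x = 0;
  jacobi : forall x y z : L,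
    lie x (lie y z) + lie y (lie z x) + lie z (lie x y) = 0
}.

#[short(type="lieAlgType")]
HB.structure Definition LieAlg (F : fieldType) :=
  {L of Vector F L & Vector_isLie F L}.

Section LieTheory.
Variables (F : fieldType) (L : lieAlgType F).
Implicit Types x y z : L.

HB.instance Definition _ x := GRing.isLinear.Build F L L _ (lie x) (lie_linearr x).

Lemma lieDl x y z : lie (x + y) z = lie x z + lie y z.
Proof. by have := lie_linearl z 1 x y; rewrite /= !scale1r. Qed.

Lemma lieDr x y z : lie x (y + z) = lie x y + lie x z.
Proof. exact: linearD. Qed.

Lemma lieC x y : lie x y = - lie y x.
Proof.
apply/eqP; rewrite -addr_eq0; apply/eqP.
by have := liexx (x + y); rewrite lieDl !lieDr !liexx add0r addr0.
Qed.

Lemma lieNr x y : lie x (- y) = - lie x y. Proof. exact: linearN. Qed.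

Lemma lie_jacobi x y z : lie x (lie y z) = lie (lie x y) z + lie y (lie x z).
Proof.
have /eqP := jacobi x y z; rewrite -addrA addr_eq0 => /eqP->.
by rewrite opprD -lieNr -!lieC addrC.
Qed.

End LieTheory.

Section DiffFun.
Variables (F : fieldType) (L : lieAlgType F).

(* The Chevalley-Eilenberg differential                                       *)
(*   (d f)(x_0, .., x_k) = \sum_(i < j) (-1)^(i + j)                          *)
(*      f([x_i, x_j], x_0, .., ^x_i, .., ^x_j, .., x_k)                       *)
(* with the bracket moved back to position i, which cancels (-1)^i.           *)
Definition diff_fun k (f : ('I_k -> L) -> F^o) : ('I_k.+1 -> L) -> F^o :=
  fun x => \sum_(j < k.+1) \sum_(i < k | (i < j)%N)
    let y := x \o lift j in (-1) ^+ j *: f (upd y i (lie (y i) (x j))).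

Definition contract_fun A k (f : ('I_k.+1 -> L) -> F^o) : ('I_k -> L) -> F^o :=
  fun y => f (fcons A y).

Definition lieder_fun A k (f : ('I_k -> L) -> F^o) : ('I_k -> L) -> F^o :=
  fun y => - \sum_j f (upd y j (lie A (y j))).

Lemma contract_fun_is_alt A k (f : ('I_k.+1 -> L) -> F^o) :
  f \in @is_altform F L k.+1 -> contract_fun A f \in @is_altform F L k.
Proof.
move=> /is_altformP[fl fa]; apply/is_altformP; split=> [x i a u v|x i j ij xij].
  by rewrite /contract_fun -!upd_fconsS fl.
by apply: (fa _ (lift ord0 i) (lift ord0 j)); rewrite ?(inj_eq lift_inj) ?fconsS.
Qed.

Lemma lieder_fun_is_alt A k (f : ('I_k -> L) -> F^o) :
  f \in @is_altform F L k -> lieder_fun A f \in @is_altform F L k.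
Proof.
move=> /is_altformP[fl fa]; apply/is_altformP; split=> [x i a u v|x i j ij xij].
  rewrite /lieder_fun /= scalerN -opprD scaler_sumr -big_split /=; congr (- _).
  apply: eq_bigr => h _; case: (eqVneq h i) => [->|hi].
    by rewrite !upd_same !upd_upd linearP fl.
  by rewrite !upd_diff // ![upd (upd _ i _) h _]updC 1?eq_sym // fl.
rewrite /lieder_fun (bigD1 i) //= (bigD1 j) 1?eq_sym //= big1 ?addr0 => [|h /andP[hi hj]].
  have -> w : f (upd x j w) = - f (upd x i w).
    rewrite -{1}(upd_id x i) (alt_swap _ _ _ fl fa) // xij.
    by rewrite updC // upd_id.
  by rewrite xij subrr oppr0.
by apply: (fa _ i j ij); rewrite !upd_diff // eq_sym.
Qed.

Lemma diff_fun0 (f : ('I_0 -> L) -> F^o) x : diff_fun f x = 0.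
Proof. by rewrite /diff_fun big1 // => j _; rewrite big_ord0. Qed.

Lemma diff_fun_fcons A k (f : ('I_k.+1 -> L) -> F^o) y :
  f \in @is_altform F L k.+1 ->
  diff_fun f (fcons A y) = lieder_fun A f y - diff_fun (contract_fun A f) y.
Proof.
move=> /is_altformP[fl fa]; rewrite /diff_fun big_ord_recl big1 ?add0r //.
rewrite /lieder_fun -sumrN -sumrB; apply: eq_bigr => j _.
rewrite fcons_lift fconsS big_mkcond big_ord_recl /=; congr (_ + _).
  rewrite fcons0 upd_fcons0 alt_move // scalerA.
  have -> : (-1) ^+ lift ord0 j = - (-1) ^+ j :> F by rewrite /= /bump /= exprS mulN1r.
  by rewrite mulNr -expr2 sqrr_sign scaleN1r.
rewrite -big_mkcond -sumrN /=; apply: eq_big => [i //|i ij].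
by rewrite fconsS upd_fconsS /bump /= exprS mulN1r scaleNr.
Qed.

Lemma diff_fun_is_alt k (f : ('I_k -> L) -> F^o) :
  f \in @is_altform F L k -> diff_fun f \in @is_altform F L k.+1.
Proof.
elim: k f => [|k IH] f fA.
  have -> : diff_fun f = 0 by apply/funext => x; rewrite diff_fun0.
  exact: rpred0.
have Gl A y : diff_fun f (fcons A y) = lieder_fun A f y - diff_fun (contract_fun A f) y.
  exact: diff_fun_fcons.
have GA A : lieder_fun A f - diff_fun (contract_fun A f) \in @is_altform F L k.+1.
  by rewrite rpredB ?lieder_fun_is_alt ?IH ?contract_fun_is_alt.
have Gc A : contract_fun A (diff_fun f) = lieder_fun A f - diff_fun (contract_fun A f).
  by apply/funext => y; exact: Gl.
have fAA A : contract_fun A f \in @is_altform F L k by exact: contract_fun_is_alt.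
have /is_altformP[fl fa] := fA.
apply/is_altformP; split=> [x i a u v|].
  rewrite (fcons_eta x); case: (unliftP ord0 i) => [j|] ->.
    have /is_altformP[+ _] := GA (x ord0) => /(_ (x \o lift ord0) j a u v) /=.
    by rewrite -Gc /contract_fun !upd_fconsS.
  have El y : lieder_fun (a *: u + v) f y = a *: lieder_fun u f y + lieder_fun v f y.
    rewrite /lieder_fun scalerN -opprD scaler_sumr -big_split /=; congr (- _).
    by apply: eq_bigr => j _; rewrite lie_linearl fl.
  have Ed y : diff_fun (contract_fun (a *: u + v) f) y =
      a *: diff_fun (contract_fun u f) y + diff_fun (contract_fun v f) y.
    rewrite /diff_fun scaler_sumr -big_split; apply: eq_bigr => j _.
    rewrite scaler_sumr -big_split; apply: eq_bigr => h _ /=.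
    set z := upd _ _ _.
    have := fl (fcons u z) ord0 a u v; rewrite /contract_fun !upd_fcons0 => ->.
    by rewrite scalerDr !scalerA mulrC.
  by rewrite !upd_fcons0 !Gl El Ed scalerBr opprD addrACA.
have f0 z : f (fcons 0 z) = 0.
  have := fl (fcons 0 z) ord0 (-1) 0 0.
  by rewrite /= scaler0 addr0 scaleN1r addNr upd_fcons0.
have key0 A z : diff_fun f (fcons A (fcons A z)) = 0.
  rewrite Gl; have -> : lieder_fun A f (fcons A z) = lieder_fun A (contract_fun A f) z.
    rewrite /lieder_fun big_ord_recl fcons0 upd_fcons0 liexx f0 add0r.
    by congr (- _); apply: eq_bigr => j _; rewrite fconsS upd_fconsS.
  case: k f fA {IH Gl GA Gc f0} fl fa fAA z => [|k] f fA fl fa fAA z.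
    by rewrite diff_fun0 subr0 /lieder_fun big_ord0 oppr0.
  rewrite diff_fun_fcons // opprB addrC subrK.
  have -> : contract_fun A (contract_fun A f) = 0.
    apply/funext => y; apply: (fa _ ord0 (lift ord0 ord0)) => //.
    by rewrite fconsS !fcons0.
  rewrite /diff_fun big1 // => j _; rewrite big1 // => i _ /=.
  exact: scaler0.
have key A y b : y b = A -> diff_fun f (fcons A y) = 0.
  move=> yb; case: (unliftP ord0 b) yb => [c ->|->] yb; last first.
    by rewrite (fcons_eta y) yb key0.
  have /is_altformP[gl ga] := GA A.
  rewrite -/(contract_fun A (diff_fun f) y) Gc -[y](upd_id y (lift ord0 c)) yb.
  rewrite -[X in upd X _ _](upd_id y ord0) alt_swap //.
  rewrite -Gc /contract_fun (fcons_eta (upd _ (lift _ _) _)) upd_diff // upd_same.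
  by rewrite key0 oppr0.
move=> x i j; rewrite (fcons_eta x).
case: (unliftP ord0 i) => [i'|] ->; case: (unliftP ord0 j) => [j'|] ->;
  rewrite ?fconsS ?fcons0 ?eqxx //.
- rewrite (inj_eq lift_inj) => ij xij; have /is_altformP[_ ga] := GA (x ord0).
  by rewrite Gl; exact: ga ij xij.
- by move=> _; exact: key.
- by move=> _ /esym; exact: key.
Qed.

End DiffFun.

Section Pullback.
Variables (F : fieldType) (M L : vectType F) (phi : {linear M -> L}).

Fact pullback_is_alt k (f : altform L k) :
  (fun x : 'I_k -> M => f (phi \o x)) \in @is_altform F M k.
Proof.
apply/is_altformP; split=> [x i a u v|x i j ij xij].
  by rewrite !comp_upd linearP (altfun_ml f).
by apply: (altfun_alt f ij); rewrite /= xij.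
Qed.

Definition pullback k (f : altform L k) : altform M k :=
  AltForm (pullback_is_alt f).

Fact pullback_is_linear k : linear (@pullback k).
Proof. by move=> a f g; exact: altform_ext. Qed.

HB.instance Definition _ k := GRing.isLinear.Build F (altform L k) (altform M k)
  _ (@pullback k) (@pullback_is_linear k).

End Pullback.

Section Forms.
Variables (F : fieldType) (L : lieAlgType F).

Definition diff k (f : altform L k) : altform L k.+1 :=
  AltForm (diff_fun_is_alt (altfunP f)).

Definition contract (A : L) k (f : altform L k.+1) : altform L k :=
  AltForm (contract_fun_is_alt A (altfunP f)).

Definition lieder (A : L) k (f : altform L k) : altform L k :=
  AltForm (lieder_fun_is_alt A (altfunP f)).

Fact diff_is_linear k : linear (@diff k).
Proof.
move=> a f g; apply: altform_ext => x.
rewrite altformD altformZ /= /diff_fun scaler_sumr -big_split.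
apply: eq_bigr => j _; rewrite scaler_sumr -big_split; apply: eq_bigr => i _ /=.
by rewrite -[LHS]/(_ *: (a *: f _ + g _)) scalerDr !scalerA [a * _]mulrC.
Qed.
HB.instance Definition _ k := GRing.isLinear.Build F (altform L k)
  (altform L k.+1) _ (@diff k) (@diff_is_linear k).

Fact contract_is_linear A k : linear (@contract A k).
Proof. by move=> a f g; exact: altform_ext. Qed.
HB.instance Definition _ A k := GRing.isLinear.Build F (altform L k.+1)
  (altform L k) _ (@contract A k) (@contract_is_linear A k).

Fact lieder_is_linear A k : linear (@lieder A k).
Proof.
move=> a f g; apply: altform_ext => x.
rewrite altformD altformZ /= /lieder_fun scalerN -opprD scaler_sumr -big_split.
by congr (- _); apply: eq_bigr.
Qed.
HB.instance Definition _ A k := GRing.isLinear.Build F (altform L k)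
  (altform L k) _ (@lieder A k) (@lieder_is_linear A k).

Lemma diff0E (f : altform L 0) : diff f = 0.
Proof. by apply: altform_ext => x; exact: diff_fun0. Qed.

Lemma lieder0E A (f : altform L 0) : lieder A f = 0.
Proof. by apply: altform_ext => x; rewrite /= /lieder_fun big_ord0 oppr0. Qed.

Lemma contract_inj k (f g : altform L k.+1) :
  (forall A, contract A f = contract A g) -> f = g.
Proof.
move=> fg; apply: altform_ext => x; rewrite (fcons_eta x).
by have /(congr1 (fun h : altform L k => h (x \o lift ord0))) := fg (x ord0).
Qed.

Lemma cartan A k (f : altform L k.+1) :
  contract A (diff f) = lieder A f - diff (contract A f).
Proof. by apply: altform_ext => y; exact: diff_fun_fcons (altfunP f). Qed.

Lemma contract_diff0 A (f : altform L 0) : contract A (diff f) = 0.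
Proof. by rewrite diff0E linear0. Qed.

Lemma contract_lieder A B k (f : altform L k.+1) :
  contract B (lieder A f) = lieder A (contract B f) - contract (lie A B) f.
Proof.
apply: altform_ext => y; rewrite /= /contract_fun /lieder_fun big_ord_recl.
rewrite fcons0 upd_fcons0 opprD addrC; congr (- _ + _).
by apply: eq_bigr => j _; rewrite fconsS upd_fconsS.
Qed.

Lemma contractDl A B k (f : altform L k.+1) :
  contract (A + B) f = contract A f + contract B f.
Proof.
apply: altform_ext => y; rewrite altformD /= /contract_fun.
have := altfun_ml f (fcons 0 y) ord0 1 A B.
by rewrite /= !upd_fcons0 !scale1r.
Qed.

Lemma lieder_lie A B k (f : altform L k) :
  lieder (lie A B) f = lieder A (lieder B f) - lieder B (lieder A f).
Proof.
elim: k f => [|k IH] f; first by rewrite !lieder0E subrr.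
apply: contract_inj => C; rewrite linearB /= !contract_lieder !linearB /=.
rewrite IH (lie_jacobi A B C) contractDl.
apply: altform_ext => x; rewrite !(altformD, altformN); ring.
Qed.

Lemma lieder_diff A k (f : altform L k) : lieder A (diff f) = diff (lieder A f).
Proof.
elim: k f => [|k IH] f.
  by rewrite lieder0E diff0E !linear0.
apply: contract_inj => B; rewrite contract_lieder !cartan contract_lieder.
rewrite !linearB /= IH lieder_lie.
apply: altform_ext => x; rewrite !(altformD, altformN); ring.
Qed.

Lemma diff_diff k (f : altform L k) : diff (diff f) = 0.
Proof.
elim: k f => [|k IH] f; first by rewrite diff0E linear0.
apply: contract_inj => A; rewrite cartan cartan linearB /= IH subr0.
by rewrite lieder_diff subrr linear0.
Qed.

End Forms.

Lemma diff_pullback (F : fieldType) (M L : lieAlgType F) (phi : {linear M -> L}) :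
  {morph phi : x y / lie x y >-> lie x y} ->
  forall k (f : altform L k), diff (pullback phi f) = pullback phi (diff f).
Proof.
move=> phiM k f; apply: altform_ext => x; apply: eq_bigr => j _.
by apply: eq_bigr => i _; rewrite /= comp_upd phiM.
Qed.

Section Cohomology.
Variables (F : fieldType) (L : lieAlgType F).

Definition cocycles k : {vspace altform L k} := lker (linfun (@diff F L k)).

Definition coboundaries k : {vspace altform L k} :=
  if k is k'.+1 then limg (linfun (@diff F L k')) else 0%VS.

Lemma cocyclesP k (f : altform L k) : reflect (diff f = 0) (f \in cocycles k).
Proof. by rewrite memv_ker lfunE; exact: eqP. Qed.

Lemma coboundariesP k (f : altform L k.+1) :
  reflect (exists g, f = diff g) (f \in coboundaries k.+1).
Proof.
apply: (iffP memv_imgP) => [[g _ ->]|[g ->]]; exists g => //.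
  by rewrite lfunE.
- exact: memvf.
- by rewrite lfunE.
Qed.

Lemma coboundaries_sub k : (coboundaries k <= cocycles k)%VS.
Proof.
case: k => [|k]; first exact: sub0v.
by apply/subvP => f /coboundariesP[g ->]; apply/cocyclesP; exact: diff_diff.
Qed.

(* H^k = Z^k / B^k; the subspace B^k is viewed inside the space Z^k.          *)
Definition coho k : Type :=
  vquot (linfun (@vsval F _ (cocycles k)) @^-1: coboundaries k)%VS.

HB.instance Definition _ k := Vector.on (coho k).

Definition coho_class k (f : subvs_of (cocycles k)) : coho k := vproj _ f.

Lemma coho_class_eq0 k (f : subvs_of (cocycles k)) :
  (coho_class f == 0) = (vsval f \in coboundaries k).
Proof. by rewrite [LHS]vproj_eq0 -memv_preim lfunE. Qed.

Definition betti k : nat := \dim {: coho k}.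

End Cohomology.

Section Ideals.
Variables (F : fieldType) (L : lieAlgType F).

Record lieIdeal := LieIdeal {
  lieideal_val :> {vspace L};
  lieideal_closed : forall x y : L, y \in lieideal_val -> lie x y \in lieideal_val }.

(* By bilinearity this is the span of all brackets [u, v] with u in U and     *)
(* v in V, see mem_lie_span.                                                  *)
Definition lie_span (U V : {vspace L}) : {vspace L} :=
  <<[seq lie u v | u <- vbasis U, v <- vbasis V]>>%VS.

Lemma mem_lie_span (U V : {vspace L}) (u v : L) :
  u \in U -> v \in V -> lie u v \in lie_span U V.
Proof.
move=> uU vV; rewrite (coord_vbasis uU) (coord_vbasis vV).
rewrite linear_sum; apply: rpred_sum => j _; rewrite linearZ rpredZ //=.
rewrite lieC linear_sum rpredN; apply: rpred_sum => i _.
rewrite linearZ rpredZ //= lieC rpredN memv_span //.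
by apply/allpairsP; exists ((vbasis U)`_i, (vbasis V)`_j);
  rewrite !mem_nth ?size_tuple.
Qed.

Definition derived_algebra : {vspace L} := lie_span fullv fullv.

Definition derived_series n : {vspace L} := iter n (fun U => lie_span U U) fullv.

Definition lie_solvable : Prop := exists n, derived_series n = 0%VS.

End Ideals.

Section IdealLie.
Variables (F : fieldType) (L : lieAlgType F) (K : lieIdeal L).
Local Notation sK := (subvs_of K).

Definition subvs_lie (x y : sK) : sK :=
  Subvs (lieideal_closed (vsval x) (subvsP y)).

Fact subvs_lie_linearl y : linear (subvs_lie^~ y).
Proof. by move=> a u v; apply/val_inj; rewrite /= lie_linearl. Qed.
Fact subvs_lie_linearr x : linear (subvs_lie x).
Proof. by move=> a u v; apply/val_inj; rewrite /= lie_linearr. Qed.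
Fact subvs_liexx x : subvs_lie x x = 0.
Proof. by apply/val_inj; rewrite /= liexx. Qed.
Fact subvs_jacobi x y z :
  subvs_lie x (subvs_lie y z) + subvs_lie y (subvs_lie z x) +
  subvs_lie z (subvs_lie x y) = 0.
Proof. by apply/val_inj; rewrite /= jacobi. Qed.

HB.instance Definition _ := Vector_isLie.Build F (subvs_of K)
  subvs_lie_linearl subvs_lie_linearr subvs_liexx subvs_jacobi.

Definition restrict k (f : altform L k) : altform sK k := pullback vsval f.

(* The extension is by means of some linear projection of L onto K; by        *)
(* coho_actE below the choice of the extension is irrelevant.                 *)
Definition extend k (f : altform sK k) : altform L k := pullback (vsproj K) f.

Lemma restrict_diff k (f : altform L k) : restrict (diff f) = diff (restrict f).
Proof. by rewrite /restrict diff_pullback. Qed.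

Lemma extendK k : cancel (@extend k) (@restrict k).
Proof.
move=> f; apply: altform_ext => x /=; congr (f _); apply/funext => i /=.
exact: vsvalK.
Qed.

(* A _| d f *)
Definition act_form A k (f : altform L k) : altform sK k :=
  restrict (contract A (diff f)).

Lemma restrict_lieder0 A k (f : altform L k) :
  restrict f = 0 -> restrict (lieder A f) = 0.
Proof.
move=> f0; apply: altform_ext => x; rewrite /= /lieder_fun big1 ?oppr0 // => j _.
have kx : lie A (vsval (x j)) \in K by exact/lieideal_closed/subvsP.
have /(congr1 (fun g : altform sK k => g (upd x j (Subvs kx)))) := f0.
by rewrite /= comp_upd.
Qed.

Lemma act_form_closed A k (f : altform L k) :
  restrict f \in cocycles sK k -> act_form A f \in cocycles sK k.
Proof.
move=> /cocyclesP f0; apply/cocyclesP; rewrite /act_form -restrict_diff.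
have /eqP := cartan A (diff f); rewrite diff_diff linear0 eq_sym subr_eq0.
by move=> /eqP <-; apply: restrict_lieder0; rewrite restrict_diff.
Qed.

Lemma act_form_exact A k (f : altform L k) :
  restrict f \in coboundaries sK k -> act_form A f \in coboundaries sK k.
Proof.
case: k f => [|k] f; first by rewrite /act_form contract_diff0 /restrict linear0 !mem0v.
move=> /coboundariesP[g fg]; apply/coboundariesP.
pose h := f - diff (extend g).
have h0 : restrict h = 0.
  by rewrite /h /restrict linearB /= -/(restrict _) -/(restrict _) restrict_diff extendK fg subrr.
exists (- restrict (contract A h)).
have -> : act_form A f = act_form A h.
  by rewrite /act_form /h linearB /= diff_diff subr0.
rewrite /act_form cartan /restrict linearB /= -!/(restrict _).
by rewrite restrict_lieder0 // restrict_diff sub0r linearN.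
Qed.

Lemma extend_closed k (f : subvs_of (cocycles sK k)) :
  restrict (extend (vsval f)) \in cocycles sK k.
Proof. by rewrite extendK; exact: subvsP. Qed.

(* The action A . [f] = [A _| d f] of L on the cohomology of K.               *)
Definition coho_act (A : L) k (b : coho sK k) : coho sK k :=
  coho_class (Subvs (act_form_closed A (extend_closed (vrepr b)))).

(* It depends neither on the cocycle f nor on its extension f'.               *)
Lemma coho_actE A k (f : subvs_of (cocycles sK k)) (f' : altform L k)
    (ff' : restrict f' = vsval f) (cf' : restrict f' \in cocycles sK k) :
  coho_act A (coho_class f) = coho_class (Subvs (act_form_closed A cf')).
Proof.
apply/eqP; rewrite vproj_eq -memv_preim lfunE /=.
set g := vrepr _; have -> : act_form A (extend (vsval g)) - act_form A f' =
    act_form A (extend (vsval g) - f').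
  by rewrite /act_form /restrict !linearB.
apply: act_form_exact; rewrite {1}/restrict linearB /= -!/(restrict _) extendK ff'.
have : vproj _ g == coho_class f by rewrite vreprK.
by rewrite vproj_eq -memv_preim lfunE.
Qed.

Definition coho_invariants k : set (coho sK k) :=
  [set b | forall A : L, coho_act A b = 0].

End IdealLie.

Arguments coho_invariants {F L} K k : rename.

Definition trivial34 (F : fieldType) (L : lieAlgType F) : Prop :=
  betti L 3 = 0%N /\ betti L 4 = 0%N.

(* Main.v *)
Require Import Defs.
From HB Require Import structures.
From mathcomp Require Import all_boot all_order all_algebra.
From mathcomp Require Import all_classical all_reals.
From mathcomp Require spectral.
From mathcomp Require Import complex zify ring.

(* For a codimension one ideal K and A outside K, writing forms on g as
   a + A* /\ b turns the action of A on H(K) into the connecting map of the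
   Gysin sequence, so b_i(g) = 0 iff A acts injectively on H^i(K) and
   surjectively, i.e. injectively, on H^(i-1)(K). As K acts trivially on H(K),
   this gives the equivalence for solvable g.

   That b_3(g) = 0 forces g solvable is shown without the Levi decomposition.
   If the closed form kappa([x, y], z), kappa the Killing form, equals d b, then
   so does its restriction to a minimal nonsolvable subalgebra L. Such an L is
   simple: a minimal ideal M of L is also maximal and abelian, and a Casimir
   operator exhibits a complement of M, which is solvable, so that L would be
   solvable. On the simple algebra L the form f = kappa + b (for the right sign of b) is a
   1-cocycle with values in the coadjoint module, hence, by the Casimir
   operator again, a coboundary and so alternating; thus kappa vanishes on L,
   which contradicts Cartan's criterion and Engel's theorem. Cartan's criterion
   is proved over R[i] with a polynomial q such that q(ad x) acts as the complex
   conjugate of mu on each generalized mu-eigenspace. *)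

Set Implicit Arguments.
Unset Strict Implicit.
Unset Printing Implicit Defensive.

Import GRing.Theory Num.Theory.
Local Open Scope ring_scope.
Local Open Scope classical_set_scope.

(** * Functions of a complex matrix on generalized eigenspaces *)

Lemma prod_XsubC_split (F : fieldType) (z : F) (r : seq F) :
  \prod_(w <- r) ('X - w%:P) =
  ('X - z%:P) ^+ count_mem z r * \prod_(w <- [seq w <- r | w != z]) ('X - w%:P).
Proof.
elim: r => [|w r IH]; first by rewrite !big_nil expr0 mulr1.
rewrite big_cons IH /=; case: eqP => [->|_] /=; first by rewrite mulrA -exprS.
by rewrite add0n big_cons mulrCA.
Qed.

Lemma horner_mx_XsubC (F : fieldType) n (A : 'M[F]_n.+1) z k :
  horner_mx A (('X - z%:P) ^+ k) = (A - z%:M) ^+ k.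
Proof. by rewrite rmorphXn rmorphB /= horner_mx_X horner_mx_C. Qed.

(** Primary decomposition as an induction principle. Bezout for the coprime polynomials
    [('X - z%:P) ^+ k] and [Q] splits [u] into a generalized eigenvector for [z] and a vector killed
    by [Q], which has fewer roots. *)
Lemma geigen_ind_root (F : fieldType) n (A : 'M[F]_n.+1) (P : 'rV[F]_n.+1 -> Prop)
    (N : nat) (r : seq F) :
  P 0 -> (forall u v, P u -> P v -> P (u + v)) ->
  (forall z u, z \in r -> u *m (A - z%:M) ^+ N = 0 -> P u) ->
  (size r <= N)%N ->
  forall u, u *m horner_mx A (\prod_(z <- r) ('X - z%:P)) = 0 -> P u.
Proof.
move=> P0 PD; have [m] := ubnP (size r); elim: m r => // m IH [|z r] szr PE rN u.
  by rewrite big_nil rmorph1 mulmx1 => ->.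
rewrite (prod_XsubC_split z); set k := count_mem _ _; set r' := seq.filter _ _.
set Q := \prod_(w <- _) _ => uQ.
have r's : {subset r' <= z :: r} by move=> w; rewrite mem_filter => /andP[].
have kN : (k <= N)%N by rewrite (leq_trans (count_size _ _)).
have szr' : (size r' < size (z :: r))%N.
  by rewrite size_filter -(count_predC (pred1 z) (z :: r)) /= eqxx -addn1 addnC leq_add2r.
have /Bezout_eq1_coprimepP[[a b] /= ab] : coprimep (('X - z%:P) ^+ k) Q.
  apply: coprimep_expl; rewrite coprimep_sym coprimep_XsubC root_prod_XsubC.
  by rewrite mem_filter eqxx.
have kill c d e : c * d = e * (('X - z%:P) ^+ k * Q) ->
    u *m horner_mx A c *m horner_mx A d = 0.
  move=> cde; rewrite -mulmxA mulmxE -rmorphM cde mulrC rmorphM -mulmxE mulmxA.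
  by rewrite uQ mul0mx.
have -> : u = u *m horner_mx A (a * ('X - z%:P) ^+ k) + u *m horner_mx A (b * Q).
  by rewrite -mulmxDr -rmorphD ab rmorph1 mulmx1.
apply: PD.
  apply: (IH r') => [|||]; first by rewrite (leq_trans szr').
  - by move=> w v /r's; exact: PE.
  - by rewrite (leq_trans _ rN) // ltnW.
  - by apply: (kill _ _ a); rewrite mulrA.
apply: (PE z); rewrite ?mem_head // -horner_mx_XsubC -(subnK kN) exprD.
by apply: (kill _ _ (b * ('X - z%:P) ^+ (N - k))); ring.
Qed.

(** By Cayley-Hamilton the characteristic polynomial kills every vector. Its degree [n.+1] bounds
    all multiplicities, so one exponent serves every eigenvalue. *)
Lemma geigen_ind (F : closedFieldType) n (A : 'M[F]_n.+1) (P : 'rV[F]_n.+1 -> Prop) :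
  P 0 -> (forall u v, P u -> P v -> P (u + v)) ->
  (forall z u, root (char_poly A) z -> u *m (A - z%:M) ^+ n.+1 = 0 -> P u) ->
  forall u, P u.
Proof.
move=> P0 PD PE u; have [r rE] := closed_field_poly_normal (char_poly A).
move: rE; rewrite (monicP (char_poly_monic A)) scale1r => rE.
apply: (geigen_ind_root (A := A) (N := n.+1) (r := r) P0 PD).
- by move=> z v zr; apply: PE; rewrite rE root_prod_XsubC.
- by rewrite -ltnS -(size_prod_XsubC r id) -rE size_char_poly.
- by rewrite -rE Cayley_Hamilton mulmx0.
Qed.

(** Chinese remainder theorem, one point at a time: [b * M] is 1 modulo [('X - z%:P) ^+ N] and 0
    modulo the same power at the other points of the list, so the correction term changes the
    residue at [z] only. *)
Lemma poly_interp (F : fieldType) (c : F -> F) (N : nat) (r : seq F) :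
  exists q : {poly F}, forall z, z \in r -> ('X - z%:P) ^+ N %| q - (c z)%:P.
Proof.
have := undup_uniq r; have := mem_undup r.
move: (undup r) => s sr us.
suff [q qP] : exists q : {poly F}, forall z, z \in s -> ('X - z%:P) ^+ N %| q - (c z)%:P.
  by exists q => z; rewrite -sr; exact: qP.
elim: s us {sr} => [|z s IH] /= => [_|/andP[zs us]]; first by exists 0.
have [q qP] := IH us.
pose M := (\prod_(w <- s) ('X - w%:P)) ^+ N.
have wM w : w \in s -> ('X - w%:P) ^+ N %| M.
  by move=> ws; rewrite /M dvdp_exp2r // (big_rem w) //= dvdp_mulr.
have /Bezout_eq1_coprimepP[[a b] /= ab] : coprimep (('X - z%:P) ^+ N) M.
  rewrite /M; apply/coprimep_expl/coprimep_expr.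
  by rewrite coprimep_sym coprimep_XsubC root_prod_XsubC.
exists (q + b * M * ((c z)%:P - q)) => w; rewrite inE => /predU1P[->|ws].
  have -> : q + b * M * ((c z)%:P - q) - (c z)%:P =
      (q - (c z)%:P) * (1 - b * M) by ring.
  by rewrite -ab addrK dvdp_mull // dvdp_mull.
rewrite addrAC dvdp_add ?qP //.
by rewrite dvdp_mulr // dvdp_mull // wM.
Qed.

Lemma horner_mx_geigen (F : fieldType) n (A : 'M[F]_n.+1) (q : {poly F}) z c N (v : 'rV_n.+1) :
  ('X - z%:P) ^+ N %| q - c%:P -> v *m (A - z%:M) ^+ N = 0 ->
  v *m horner_mx A q = c *: v.
Proof.
move=> /dvdpP[p qE] v0; rewrite -[q](subrK c%:P) qE rmorphD /= mulmxDr horner_mx_C.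
rewrite mul_mx_scalar [p * _]mulrC rmorphM /= horner_mx_XsubC -mulmxE mulmxA v0 mul0mx.
by rewrite add0r.
Qed.

Section Intertwine.
Variables (F : closedFieldType) (m n : nat) (D : 'M[F]_m.+1) (A : 'M[F]_n.+1).
Variable T : {linear 'rV[F]_m.+1 -> 'M[F]_n.+1}.
Hypothesis TD : forall u, T (u *m D) = T u *m A - A *m T u.

(** Leibniz rule: [v T(u) (A - (a + b))] equals [v T(u (D - a)) + v (A - b) T(u)], and each summand
    lowers [i] or [j] by one. *)
Lemma intertwine_geigen a b i j u (v : 'rV_n.+1) :
  u *m (D - a%:M) ^+ i = 0 -> v *m (A - b%:M) ^+ j = 0 ->
  v *m T u *m (A - (a + b)%:M) ^+ (i + j) = 0.
Proof.
have [k] := ubnP (i + j); elim: k i j u v => // k IH i j u v ijk u0 v0.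
case: i ijk u0 => [|i] ijk u0.
  by rewrite expr0 mulmx1 in u0; rewrite u0 linear0 mulmx0 mul0mx.
case: j ijk v0 => [|j] ijk v0.
  by rewrite expr0 mulmx1 in v0; rewrite v0 !mul0mx.
have -> : v *m T u *m (A - (a + b)%:M) ^+ (i.+1 + j.+1) =
   v *m T (u *m (D - a%:M)) *m (A - (a + b)%:M) ^+ (i + j.+1) +
   v *m (A - b%:M) *m T u *m (A - (a + b)%:M) ^+ (i.+1 + j).
  rewrite addSn addnS -addSn exprS -mulmxE mulmxA -mulmxDl; congr (_ *m _).
  rewrite (mulmxBr u) mul_mx_scalar (raddfB T) /= linearZ_LR TD !mulmxBr !mul_mx_scalar.
  rewrite mulmxBl -scalemxAl -scalemxAr scalerDl !mulmxA.
  set X := _ *m A; set Y := _ *m T u; set Z := v *m T u.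
  by rewrite addrACA subrK opprD addrA.
rewrite !IH ?addr0 //; try lia; by rewrite -mulmxA mulmxE -exprS.
Qed.

Variables (c : {additive F -> F}) (q : {poly F}).
Hypothesis qD : forall z, root (char_poly D) z ->
  ('X - z%:P) ^+ (m.+1 + n.+1) %| q - (c z)%:P.
Hypothesis qA : forall z, root (char_poly A) z ->
  ('X - z%:P) ^+ (m.+1 + n.+1) %| q - (c z)%:P.
Hypothesis qDA : forall a b, root (char_poly D) a -> root (char_poly A) b ->
  ('X - (a + b)%:P) ^+ (m.+1 + n.+1) %| q - (c (a + b))%:P.

(** For [u] and [v] in the generalized eigenspaces of [a] and [b], the two sides send [v] to [c a]
    and to [c (a + b) - c b] times [v *m T u]; these agree because [c] is additive. *)
Lemma intertwine_horner u :
  T (u *m horner_mx D q) = T u *m horner_mx A q - horner_mx A q *m T u.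
Proof.
move: u; apply: (geigen_ind (A := D)) => [|u1 u2 E1 E2|a u ra ua].
- by rewrite mul0mx linear0 mul0mx mulmx0 subr0.
- by rewrite mulmxDl !linearD /= E1 E2 mulmxDl addrACA -opprD -mulmxDr -linearD.
suff H (v : 'rV_n.+1) : v *m T (u *m horner_mx D q) =
    v *m (T u *m horner_mx A q - horner_mx A q *m T u).
  by apply/row_matrixP => i; rewrite !rowE H.
move: v; apply: (geigen_ind (A := A)) => [|v1 v2 E1 E2|b v rb vb].
- by rewrite !mul0mx.
- by rewrite mulmxDl E1 E2 -mulmxDl.
have wide k (B : 'M[F]_k.+1) (w : 'rV_k.+1) z l : (l <= m.+1 + n.+1)%N ->
    w *m (B - z%:M) ^+ l = 0 -> w *m (B - z%:M) ^+ (m.+1 + n.+1) = 0.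
  by move=> lk w0; rewrite -(subnKC lk) exprD -mulmxE mulmxA w0 mul0mx.
rewrite mulmxBr !mulmxA.
rewrite (horner_mx_geigen (qD ra) (wide _ _ _ _ _ (leq_addr _ _) ua)).
rewrite (horner_mx_geigen (qA rb) (wide _ _ _ _ _ (leq_addl _ _) vb)).
rewrite (horner_mx_geigen (qDA ra rb) (intertwine_geigen ua vb)).
by rewrite linearZ /= -scalemxAr -scalemxAl raddfD scalerDl addrK.
Qed.

End Intertwine.

Lemma horner_mx_trig (F : comNzRingType) n (A : 'M[F]_n.+1) q : is_trig_mx A ->
  is_trig_mx (horner_mx A q) /\ forall i, horner_mx A q i i = q.[A i i].
Proof.
move=> tA.
have trigM (B C : 'M[F]_n.+1) : is_trig_mx B -> is_trig_mx C ->
    is_trig_mx (B * C) /\ forall i, (B * C) i i = B i i * C i i.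
  move=> /is_trig_mxP tB /is_trig_mxP tC; split=> [|i].
    apply/is_trig_mxP => i j ij; rewrite mxE big1 // => k _.
    case: (ltnP i k) => [ik|ki]; first by rewrite tB // mul0r.
    by rewrite tC ?mulr0 // (leq_ltn_trans ki).
  rewrite mxE (bigD1 i) //= big1 ?addr0 // => k ki.
  case: (ltngtP i k) => [ik|ik|ik]; first by rewrite tB // mul0r.
    by rewrite tC ?mulr0.
  by rewrite (val_inj ik) eqxx in ki.
elim/poly_ind: q => [|q z [tq qE]].
  by rewrite rmorph0; split=> [|i]; rewrite ?mx0_is_trig // horner0 mxE.
have [tqA qAE] := trigM _ _ tq tA.
rewrite rmorphD rmorphM /= horner_mx_X horner_mx_C; split=> [|i].
  apply/is_trig_mxP => i j ij; rewrite mxE (is_trig_mxP tqA) //.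
  by rewrite mxE -val_eqE (ltn_eqF ij) addr0.
by rewrite mxE qAE qE !mxE eqxx hornerMXaddC.
Qed.

(* After triangularization, tr (q(A) A) is the sum of the |mu|^2 over the
   eigenvalues mu of A, with multiplicity. *)
Lemma conj_trace_nilpotent (C : numClosedFieldType) n (A : 'M[C]_n.+1) :
  exists r : seq C, forall q : {poly C},
    (forall z, z \in r -> q.[z] = z^*) -> \tr (horner_mx A q *m A) = 0 ->
    A ^+ n.+1 = 0.
Proof.
have [P /spectral.unitarymx_unit Pu tA] := @spectral.Schur C n.+1 A isT.
pose T := P *m A *m invmx P.
have tT : is_trig_mx T by rewrite /T -conjumx.
exists [seq T i i | i <- enum 'I_n.+1] => q qP tr0.
have AE : A = invmx P *m T *m P by rewrite /T !mulmxA mulVmx // mul1mx mulmxKV.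
have [tq qE] := horner_mx_trig q tT.
have sum0 : \sum_i `|T i i| ^+ 2 = 0.
  transitivity (\tr (horner_mx T q *m T)); last first.
    rewrite /T horner_mx_uconj // !mulmxA mulmxKV // mxtrace_mulC !mulmxA.
    by rewrite mulVmx // mul1mx.
  rewrite /mxtrace; apply: eq_bigr => i _; rewrite normCKC [RHS]mxE (bigD1 i) //=.
  rewrite big1 ?addr0 => [|k ki].
    by rewrite qE qP //; apply: (map_f (fun i => T i i)); rewrite mem_enum.
  case: (ltngtP i k) => [ik|ik|ik]; last by rewrite (val_inj ik) eqxx in ki.
    by rewrite (is_trig_mxP tq) // mul0r.
  by rewrite (is_trig_mxP tT) // mulr0.
have T0 i : T i i = 0.
  apply/eqP; rewrite -normr_eq0 -sqrf_eq0; move/eqP: sum0.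
  by rewrite psumr_eq0 => [/allP/(_ i (mem_index_enum i))|j _]; rewrite ?exprn_ge0.
have Tn : T ^+ n.+1 = 0.
  have := Cayley_Hamilton T; rewrite char_poly_trig // (eq_bigr (fun=> 'X)) => [|i _].
    by rewrite prodr_const card_ord rmorphXn /= horner_mx_X.
  by rewrite T0 subr0.
have := @horner_mx_uconj _ _ 'X^(n.+1) (invmx P) T; rewrite invmxK -AE !rmorphXn /=.
by rewrite !horner_mx_X Tn mulmx0 mul0mx; apply; rewrite unitrV.
Qed.

(** * Cartan's criterion *)

Lemma lie0r (F : fieldType) (L : lieAlgType F) (x : L) : lie x 0 = 0.
Proof. exact: linear0. Qed.

Lemma lie0l (F : fieldType) (L : lieAlgType F) (x : L) : lie 0 x = 0.
Proof. by rewrite lieC lie0r oppr0. Qed.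

Lemma lieZr (F : fieldType) (L : lieAlgType F) a (x y : L) : lie x (a *: y) = a *: lie x y.
Proof. exact: linearZ. Qed.

Lemma lieZl (F : fieldType) (L : lieAlgType F) a (x y : L) : lie (a *: x) y = a *: lie x y.
Proof. by rewrite lieC lieZr -scalerN -lieC. Qed.

Lemma lieBr (F : fieldType) (L : lieAlgType F) (x y z : L) :
  lie x (y - z) = lie x y - lie x z.
Proof. exact: linearB. Qed.

Lemma lieBl (F : fieldType) (L : lieAlgType F) (x y z : L) :
  lie (x - y) z = lie x z - lie y z.
Proof. by rewrite lieC lieBr (lieC x z) (lieC y z) opprD. Qed.

Lemma mxtrace_commutator (F : comNzRingType) n (Q Y Z : 'M[F]_n) :
  \tr (Q *m (Y *m Z - Z *m Y)) = - \tr ((Y *m Q - Q *m Y) *m Z).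
Proof.
have trB (X W : 'M[F]_n) : \tr (X - W) = \tr X - \tr W by exact: raddfB.
rewrite mulmxBl mulmxBr !mulmxA !trB opprB; congr (_ - _).
by rewrite mxtrace_mulC mulmxA.
Qed.

(** Over R[i] let [q] interpolate complex conjugation at the eigenvalues of [A], the matrix of [x].
    Then tr (q(A) [Y, Z]) = - tr ([Y, q(A)] Z), and [intertwine_horner] puts [Y, q(A)] into the
    complex span of the image of [rho], so the trace vanishes by hypothesis. As [x] is a combination
    of brackets, tr (q(A) A) = 0 and [conj_trace_nilpotent] applies. *)
Lemma cartan_nilpotent (R : rcfType) (L : lieAlgType R) n
    (rho : {linear L -> 'M[R]_n}) :
  (forall x y, rho (lie x y) = rho x *m rho y - rho y *m rho x) ->
  (forall x y, \tr (rho x *m rho y) = 0) ->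
  forall x, x \in derived_algebra L -> exists k, rho x ^+ k = 0.
Proof.
case: n rho => [|n] rho rhoM tr0 x xL.
  by exists 1; apply/matrixP => -[].
pose C := R[i]; pose toC : {rmorphism R -> C} := real_complex R.
set m := \dim {:L}.
(* One index too many, so that the matrices below have nonzero size even when L = 0. The extra
   vector is the default value 0 of [nth]. *)
pose b (j : 'I_m.+1) : L := (vbasis {:L})`_j.
have /choice[cf cfP] y : exists u : 'rV[R]_m.+1, y = \sum_j u 0 j *: b j.
  exists (\row_j (if insub (val j) is Some k then coord (vbasis {:L}) k y else 0)).
  rewrite {1}(coord_vbasis (memvf y)) big_ord_recr /= !mxE /=.
  rewrite insubN ?ltnn // scale0r addr0; apply: eq_bigr => j _.
  by rewrite mxE /= insubT //= => jm; congr (coord _ _ _ *: _); exact: val_inj.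
pose rC y : 'M[C]_n.+1 := map_mx toC (rho y).
have rCD : {morph rC : y z / y + z} by move=> y z; rewrite /rC linearD map_mxD.
have rCZ a y : rC (a *: y) = toC a *: rC y by rewrite /rC linearZ /= map_mxZ.
have rC_sum I (r : seq I) (f : I -> L) : rC (\sum_(j <- r) f j) = \sum_(j <- r) rC (f j).
  apply: (big_morph rC rCD); by rewrite /rC linear0 map_mx0.
pose T (u : 'rV[C]_m.+1) : 'M[C]_n.+1 := \sum_j u 0 j *: rC (b j).
have Tlin : linear T.
  move=> a u v; rewrite /T scaler_sumr -big_split; apply: eq_bigr => j _ /=.
  by rewrite !mxE scalerDl scalerA.
pose Tl : {linear 'rV[C]_m.+1 -> 'M[C]_n.+1} :=
  HB.pack T (GRing.isLinear.Build _ _ _ _ T Tlin).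
have Tcf y : T (map_mx toC (cf y)) = rC y.
  by rewrite {2}(cfP y) rC_sum; apply: eq_bigr => j _; rewrite mxE rCZ.
pose A := rC x.
(* The matrix of y |-> [y, x] = - [x, y], whence the sign. *)
pose D : 'M[C]_m.+1 := map_mx toC (\matrix_(i, j) - cf (lie x (b i)) 0 j).
have TD u : Tl (u *m D) = Tl u *m A - A *m Tl u.
  transitivity (\sum_i u 0 i *: - rC (lie x (b i))).
    rewrite /= /T (eq_bigr (fun j => \sum_i (u 0 i * D i j) *: rC (b j))) => [|j _].
    rewrite exchange_big /=; apply: eq_bigr => i _.
    rewrite [in RHS](cfP (lie x (b i))) rC_sum -sumrN scaler_sumr.
    by apply: eq_bigr => j _; rewrite !mxE rCZ rmorphN mulrN scaleNr scalerN scalerA.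
    by rewrite mxE scaler_suml.
  rewrite /= /T mulmx_suml mulmx_sumr -sumrB; apply: eq_bigr => i _.
  by rewrite -scalemxAl -scalemxAr -scalerBr /rC rhoM map_mxB !map_mxM opprB.
have [r rP] := conj_trace_nilpotent A.
have [rA rAE] := closed_field_poly_normal (char_poly A).
have [rD rDE] := closed_field_poly_normal (char_poly D).
have memA z : root (char_poly A) z -> z \in rA.
  by rewrite rAE (monicP (char_poly_monic A)) scale1r root_prod_XsubC.
have memD z : root (char_poly D) z -> z \in rD.
  by rewrite rDE (monicP (char_poly_monic D)) scale1r root_prod_XsubC.
(* The points are those asked for by [conj_trace_nilpotent], the eigenvalues of [A] and of [D], and
   the sums needed in [intertwine_horner]. *)
have [q qP] := poly_interp (Num.conj : C -> C) (m.+1 + n.+1)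
  (r ++ rA ++ rD ++ [seq a + c | a <- rD, c <- rA]).
have inter := intertwine_horner (c := Num.conj) TD _ _ _.
have key y z : \tr (horner_mx A q *m rC (lie y z)) = 0.
  pose u := map_mx toC (cf y).
  have -> : \tr (horner_mx A q *m rC (lie y z)) = - \tr (T (u *m horner_mx D q) *m rC z).
    rewrite -[T _]/(Tl _) inter.
    - by rewrite /= Tcf /rC rhoM map_mxB !map_mxM mxtrace_commutator.
    - by move=> a /memD aD; rewrite qP // !mem_cat aD !orbT.
    - by move=> a /memA aA; rewrite qP // !mem_cat aA !orbT.
    - move=> a c /memD aD /memA cA; rewrite qP // !mem_cat.
      by rewrite (allpairs_f (fun a c => a + c)) ?orbT.
  rewrite /T mulmx_suml [\tr _]linear_sum big1 ?oppr0 // => j _ /=.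
  by rewrite -scalemxAl linearZ /= -map_mxM trace_map_mx tr0 rmorph0 mulr0.
have trx : \tr (horner_mx A q *m A) = 0.
  suff trB w : w \in derived_algebra L -> \tr (horner_mx A q *m rC w) = 0 by exact: trB.
  rewrite /derived_algebra /lie_span.
  set X := [seq _ | _ <- _, _ <- _] => /(@coord_span _ _ _ (in_tuple X))->.
  rewrite rC_sum mulmx_sumr linear_sum big1 // => i _ /=.
  rewrite rCZ -scalemxAr linearZ /=.
  have /allpairsP[[y z] [_ _ /= ->]] := mem_nth 0 (ltn_ord i).
  by rewrite key mulr0.
have An : A ^+ n.+1 = 0.
  apply: (rP q) => // z zr.
  have zr' : z \in r ++ rA ++ rD ++ [seq a + c | a <- rD, c <- rA].
    by rewrite mem_cat zr.
  have := dvdp_trans (dvdp_exp (ltn0Sn (m + n.+1)) (dvdpp ('X - z%:P))) (qP z zr').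
  by rewrite dvdp_XsubCl rootE !hornerE subr_eq0 => /eqP.
exists n.+1; apply: (@map_mx_inj _ _ toC); rewrite map_mx0 -An.
exact: rmorphXn.
Qed.

(** * Solvability and Engel's theorem *)

Section Extremal.
Variables (F : fieldType) (V : vectType F).
Implicit Types U W : {vspace V}.

Lemma max_vspace (P : {vspace V} -> Prop) U0 : P U0 ->
  exists U, [/\ P U, (U0 <= U)%VS & forall W, P W -> (U <= W)%VS -> W = U].
Proof.
move=> PU0; pose Q d := `[< exists U, [/\ P U, (U0 <= U)%VS & \dim U = d] >].
have Q0 : exists d, Q d by exists (\dim U0); apply/asboolP; exists U0.
have Qm d : Q d -> (d <= \dim {:V})%N.
  by move=> /asboolP[U [_ _ <-]]; exact/dimvS/subvf.
case: (ex_maxnP Q0 Qm) => d /asboolP[U [PU U0U dU]] dmax.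
exists U; split=> // W PW UW; apply/esym/eqP; rewrite eqEdim UW dU.
by apply: dmax; apply/asboolP; exists W; split=> //; exact: subv_trans UW.
Qed.

Lemma min_vspace (P : {vspace V} -> Prop) U0 : P U0 ->
  exists U, [/\ P U, (U <= U0)%VS & forall W, P W -> (W <= U)%VS -> W = U].
Proof.
move=> PU0; pose Q d := `[< exists U, [/\ P U, (U <= U0)%VS & \dim U = d] >].
have Q0 : exists d, Q d by exists (\dim U0); apply/asboolP; exists U0.
case: (ex_minnP Q0) => d /asboolP[U [PU UU0 dU]] dmin.
exists U; split=> // W PW WU; apply/eqP; rewrite eqEdim WU dU.
by apply: dmin; apply/asboolP; exists W; split=> //; exact: subv_trans UU0.
Qed.

(** A subspace that is maximal among those inside [P] absorbs every vector satisfying [P]. *)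
Lemma vspace_of_pred (P : V -> Prop) : P 0 ->
  (forall a u v, P u -> P v -> P (a *: u + v)) ->
  exists U : {vspace V}, forall v, v \in U <-> P v.
Proof.
move=> P0 PP; pose Q U := forall v, v \in U -> P v.
have Q0 : Q 0%VS by move=> v; rewrite memv0 => /eqP->.
have [U [QU _ Umax]] := max_vspace Q0.
exists U => v; split=> [|Pv]; first exact: QU.
have <- : (U + <[v]>)%VS = U; last exact: (subvP (addvSr U <[v]>%VS)) (memv_line v).
apply: Umax (addvSl _ _) => w /memv_addP[u uU [_ /vlineP[a ->] ->]].
by rewrite addrC; apply: PP => //; exact: QU.
Qed.

Lemma vspace_neq_exists U W : (U <= W)%VS -> U <> W -> exists2 v, v \in W & v \notin U.
Proof.
move=> UW neq; have /subvPn[v] : ~~ (W <= U)%VS; last by exists v.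
by apply/negP => WU; apply: neq; apply/eqP; rewrite eqEsubv UW.
Qed.

End Extremal.

Section LieSpan.
Variables (F : fieldType) (L : lieAlgType F).
Implicit Types U V W K : {vspace L}.

Lemma lie_span_subP U V W :
  (forall u v, u \in U -> v \in V -> lie u v \in W) <-> (lie_span U V <= W)%VS.
Proof.
split=> [H|/subvP H u v uU vV]; last exact/H/mem_lie_span.
apply/span_subvP => _ /allpairsP[[u v] [/= uU vV ->]].
by apply: H; exact: vbasis_mem.
Qed.

Lemma lie_spanS U U' V V' : (U <= U')%VS -> (V <= V')%VS ->
  (lie_span U V <= lie_span U' V')%VS.
Proof.
move=> /subvP UU' /subvP VV'; apply/lie_span_subP => u v /UU' uU /VV' vV.
exact: mem_lie_span.
Qed.

Definition subalgebra U := (lie_span U U <= U)%VS.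
Definition ideal U := (lie_span fullv U <= U)%VS.

Lemma idealP U : reflect (forall x y, y \in U -> lie x y \in U) (ideal U).
Proof.
apply: (iffP idP) => [/lie_span_subP H x y yU|H]; first exact: H (memvf x) yU.
by apply/lie_span_subP => x y _; exact: H.
Qed.

Lemma ideal_liel U x y : ideal U -> x \in U -> lie x y \in U.
Proof. by move=> /idealP IU xU; rewrite lieC rpredN IU. Qed.

Lemma ideal_subalgebra U : ideal U -> subalgebra U.
Proof. exact/subv_trans/lie_spanS/subvv/subvf. Qed.

(** Unlike [derived_series] this starts at any subspace, so that solvability of a subalgebra can be
    stated inside [L]. *)
Definition derived_iter n U : {vspace L} := iter n (fun V => lie_span V V) U.
Definition solvable U := exists n, derived_iter n U = 0%VS.

Lemma derived_iterS n U V : (U <= V)%VS -> (derived_iter n U <= derived_iter n V)%VS.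
Proof. by move=> UV; elim: n => //= n IH; exact: lie_spanS. Qed.

Lemma solvable_lie_span U : solvable (lie_span U U) -> solvable U.
Proof. by move=> [n Un]; exists n.+1; rewrite /derived_iter iterSr. Qed.

Lemma derived_iterD m n U : derived_iter (m + n) U = derived_iter m (derived_iter n U).
Proof. exact: iterD. Qed.

(** As [V] is an ideal, the m-th derived term of [U + V] lies in that of [U] plus [V]. Once the
    former is 0, the series of [V] takes over. *)
Lemma solvable_ideal_add U V : ideal V -> solvable U -> solvable V ->
  solvable (U + V)%VS.
Proof.
move=> IV [m Um] [n Vn]; exists (n + m)%N; rewrite derived_iterD.
apply/eqP; rewrite -subv0 -Vn; apply: derived_iterS.
rewrite -[V in X in (_ <= X)%VS]add0v -Um.
elim: {Um} m => //= m IH; apply: subv_trans (lie_spanS IH IH) _.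
apply/lie_span_subP => _ _ /memv_addP[u uU [v vV ->]] /memv_addP[u' uU' [v' vV' ->]].
rewrite lieDl lieDr -addrA; apply: memv_add; first exact: mem_lie_span.
by apply: rpredD; [exact: (elimT (idealP V)) | exact: ideal_liel].
Qed.

Lemma subalgebra_add_line K y : subalgebra K ->
  (forall k, k \in K -> lie k y \in K) ->
  (lie_span (K + <[y]>) (K + <[y]>) <= K)%VS.
Proof.
move=> /lie_span_subP KK Ky; apply/lie_span_subP => u v.
move=> /memv_addP[k kK [_ /vlineP[a ->] ->]] /memv_addP[k' kK' [_ /vlineP[b ->] ->]].
rewrite lieDl !lieDr !lieZl !lieZr liexx !scaler0 addr0.
apply: rpredD; first by apply: rpredD; [exact: KK | apply/rpredZ/Ky].
by apply: rpredZ; rewrite lieC rpredN Ky.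
Qed.

(** * Engel's theorem modulo an ideal *)

Section Engel.
Variable U : {vspace L}.
Hypothesis IU : ideal U.
Hypothesis nilU : forall x, exists n, forall y, iter n (lie x) y \in U.

(** Induction on the dimension of [K]. A maximal proper subalgebra [K1] of [K] containing [U] is
    normalized by some [y] outside it, by induction, so K = K1 + <y>. The vectors of [W] that [K1]
    sends into [V] form a space [W1] stable under [lie y]. It has an element outside [V], and the
    last iterate of [lie y] on it that is still outside [V] is the required vector. *)
Lemma engel_step K V W : subalgebra K -> (U <= K)%VS -> (U <= V)%VS ->
  (V <= W)%VS -> V <> W -> (lie_span K V <= V)%VS -> (lie_span K W <= W)%VS ->
  exists y, [/\ y \in W, y \notin V & forall k, k \in K -> lie k y \in V].
Proof.
have [d] := ubnP (\dim K); elim: d K V W => // d IH K V W dK sK UK UV VW nVW KV KW.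
have [KU|nUK] := eqVneq K U.
  have [y yW yV] := vspace_neq_exists VW nVW; exists y; split=> // k.
  by rewrite KU => kU; apply: (subvP UV); exact: ideal_liel.
pose P K1 := [/\ subalgebra K1, (U <= K1)%VS, (K1 <= K)%VS & K1 <> K].
have PU : P U by split=> //; [exact: ideal_subalgebra | apply/eqP; rewrite eq_sym].
have [K1 [[sK1 UK1 K1K nK1] _ K1max]] := max_vspace PU.
have dK1 : (\dim K1 < d)%N.
  rewrite (leq_trans _ (_ : \dim K <= d)%N) // ltn_neqAle dimvS // andbT.
  by apply/eqP => dE; apply: nK1; apply/eqP; rewrite eqEdim K1K dE leqnn.
have sub1 X : (lie_span K X <= X)%VS -> (lie_span K1 X <= X)%VS.
  exact/subv_trans/lie_spanS/subvv.
have [y [yK yK1 K1y]] := IH K1 K1 K dK1 sK1 UK1 UK1 K1K nK1 sK1 (sub1 _ sK).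
have K1yK1 := subalgebra_add_line sK1 K1y.
have KE : (K1 + <[y]>)%VS = K.
  have K1yK : (K1 + <[y]> <= K)%VS by rewrite subv_add K1K -memvE.
  apply/eqP/negPn/negP => /eqP nK; move: yK1; rewrite -(K1max (K1 + <[y]>)%VS) //.
  - by rewrite (subvP (addvSr _ _)) ?memv_line.
  - split=> //; first exact: subv_trans (addvSl _ _).
    exact: subv_trans (addvSl _ _).
  - exact: addvSl.
have [W1 W1P] : exists W1 : {vspace L}, forall w, w \in W1 <->
    (w \in W /\ forall k, k \in K1 -> lie k w \in V).
  apply: vspace_of_pred => [|a u v [uW Hu] [vW Hv]].
    by split=> [|k _]; rewrite ?lie0r mem0v.
  split=> [|k kK]; first by rewrite rpredD ?rpredZ.
  by rewrite lieDr lieZr rpredD ?rpredZ ?Hu ?Hv.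
move/lie_span_subP: (KV) => KV'; move/lie_span_subP: (KW) => KW'.
have [w0 [w0W w0V w0K]] := IH K1 V W dK1 sK1 UK1 UV VW nVW (sub1 _ KV) (sub1 _ KW).
have W1y w : w \in W1 -> lie y w \in W1.
  move=> /W1P[wW wK]; apply/W1P; split=> [|k kK1]; first exact: KW'.
  by rewrite lie_jacobi rpredD ?wK ?K1y // KV' ?wK.
have [n nP] := nilU y.
have itW1 m : iter m (lie y) w0 \in W1.
  by elim: m => [|m IHm] /=; [exact/W1P | exact: W1y].
have ex : exists m, iter m (lie y) w0 \in V by exists n; exact: (subvP UV).
case: (ex_minnP ex) => -[|m] /= mV mmin; first by rewrite mV in w0V.
exists (iter m (lie y) w0); have /W1P[mW mK] := itW1 m; split=> //.
  by apply/negP => /mmin; rewrite ltnn.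
move=> k; rewrite -KE => /memv_addP[k1 k1K [_ /vlineP[a ->] ->]].
by rewrite lieDl lieZl; apply: rpredD; [exact: mK | exact: rpredZ].
Qed.

(** A maximal proper subalgebra [K] containing [U] is normalized by some [y] outside it. Hence K +
    <y> is everything, and all its brackets lie in [K]. *)
Lemma engel_derived : U <> fullv ->
  exists2 K : {vspace L}, K <> fullv & (derived_algebra L <= K)%VS.
Proof.
move=> nU; pose P K := [/\ subalgebra K, (U <= K)%VS & K <> fullv].
have PU : P U by split=> //; exact: ideal_subalgebra.
have [K [[sK UK nK] _ Kmax]] := max_vspace PU; exists K => //.
have [y [_ yK Ky]] := engel_step sK UK UK (subvf K) nK sK (subvf _).
have KyK := subalgebra_add_line sK Ky.
suff KE : (K + <[y]>)%VS = fullv by rewrite /derived_algebra -KE.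
apply/eqP/negPn/negP => /eqP nKy; move: yK; rewrite -(Kmax (K + <[y]>)%VS).
- by rewrite (subvP (addvSr _ _)) ?memv_line.
- by split=> //; exact: subv_trans (addvSl _ _).
- exact: addvSl.
Qed.

End Engel.
End LieSpan.

(** * Trace forms and Casimir operators *)

Definition bilin (F : fieldType) (V : vectType F) (W : lmodType F) (B : V -> V -> W) :=
  (forall y, linear (B^~ y)) /\ (forall x, linear (B x)).

Section Bilin.
Variables (F : fieldType) (V : vectType F) (W : lmodType F) (B : V -> V -> W).
Hypothesis blB : bilin B.

Lemma bilinDl x y z : B (x + y) z = B x z + B y z.
Proof. by have := blB.1 z 1 x y; rewrite /= !scale1r. Qed.
Lemma bilinDr x y z : B x (y + z) = B x y + B x z.
Proof. by have := blB.2 x 1 y z; rewrite /= !scale1r. Qed.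
Lemma bilin0l z : B 0 z = 0.
Proof. by apply: (addrI (B 0 z)); rewrite -bilinDl !addr0. Qed.
Lemma bilin0r z : B z 0 = 0.
Proof. by apply: (addrI (B z 0)); rewrite -bilinDr !addr0. Qed.
Lemma bilinZl a x z : B (a *: x) z = a *: B x z.
Proof. by have := blB.1 z a x 0; rewrite /= bilin0l !addr0. Qed.
Lemma bilinZr a x z : B x (a *: z) = a *: B x z.
Proof. by have := blB.2 x a z 0; rewrite /= bilin0r !addr0. Qed.
Lemma bilinNl x z : B (- x) z = - B x z.
Proof. by rewrite -[- x]scaleN1r bilinZl scaleN1r. Qed.
Lemma bilinNr x z : B x (- z) = - B x z.
Proof. by rewrite -[- z]scaleN1r bilinZr scaleN1r. Qed.
Lemma bilinBl x y z : B (x - y) z = B x z - B y z.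
Proof. by rewrite bilinDl bilinNl. Qed.
Lemma bilin_suml I (r : seq I) (f : I -> V) z : B (\sum_(i <- r) f i) z = \sum_(i <- r) B (f i) z.
Proof. by apply: (big_morph (B^~ z)) => [x y|]; rewrite ?bilinDl ?bilin0l. Qed.
Lemma bilin_sumr I (r : seq I) (f : I -> V) z : B z (\sum_(i <- r) f i) = \sum_(i <- r) B z (f i).
Proof. by apply: (big_morph (B z)) => [x y|]; rewrite ?bilinDr ?bilin0r. Qed.

End Bilin.

Lemma bilin_lie (F : fieldType) (L : lieAlgType F) : bilin (@lie F L).
Proof. by split=> z; [exact: lie_linearl | exact: lie_linearr]. Qed.

Section DualBases.
Variables (F : fieldType) (V : vectType F) (B : V -> V -> F^o).
Hypotheses (blB : bilin B) (symB : forall x y, B x y = B y x).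

Lemma radical_exists : exists N : {vspace V}, forall v, v \in N <-> forall w, B v w = 0.
Proof.
apply: vspace_of_pred => [w|a u v uN vN w]; first exact: bilin0l blB _.
by rewrite (bilinDl blB) (bilinZl blB) uN vN scaler0 addr0.
Qed.

Variable N : {vspace V}.
Hypothesis NP : forall v, v \in N <-> forall w, B v w = 0.

(** The Gram matrix of [B] on a complement of the radical [N] is invertible, since its kernel lies
    both in [N] and in the complement; its inverse defines [e']. The expansions hold modulo [N]
    only, as [B] may be degenerate. *)
Lemma dual_bases : exists e e' : 'I_(\dim {:V} - \dim N) -> V,
  [/\ forall i j, B (e i) (e' j) = (i == j)%:R,
      forall v, v - \sum_i B v (e' i) *: e i \in N &
      forall v, v - \sum_i B v (e i) *: e' i \in N].
Proof.
have NN v w : v \in N -> B v w = 0 by move=> /NP.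
rewrite -dimv_compl; set S := (N^C)%VS; set n := \dim S.
pose b (i : 'I_n) := (vbasis S)`_i.
pose G : 'M[F]_n := \matrix_(i, j) B (b i) (b j).
have SP v : v \in N <-> forall j : 'I_n, B v (b j) = 0.
  split=> [/NP //|v0]; apply/NP => w.
  have : w \in (N + S)%VS by rewrite addv_complf memvf.
  move=> /memv_addP[u uN [s sS ->]]; rewrite (bilinDr blB) symB NN // add0r.
  rewrite (coord_vbasis sS) (bilin_sumr blB) big1 // => j _.
  by rewrite (bilinZr blB) v0 scaler0.
have Gu : G \in unitmx.
  rewrite -row_free_unit; apply/inj_row_free => r rG.
  have sN : \sum_i r 0 i *: b i \in N.
    apply/SP => j; rewrite (bilin_suml blB); move/rowP/(_ j): rG; rewrite !mxE => rGj.
    rewrite -[RHS]rGj.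
    have H i : B (r 0 i *: b i) (b j) = r 0 i * G i j by rewrite (bilinZl blB) mxE.
    exact: (eq_bigr _ (fun i _ => H i)).
  have sS : \sum_i r 0 i *: b i \in S.
    by apply: rpred_sum => i _; rewrite rpredZ // vbasis_mem // mem_nth // size_tuple.
  have : \sum_i r 0 i *: b i \in (N :&: S)%VS by rewrite memv_cap sN.
  rewrite capv_compl memv0 => /eqP s0; apply/rowP => i; rewrite mxE.
  have := coord_sum_free (fun i => r 0 i) i (basis_free (vbasisP S)).
  by rewrite s0 linear0.
pose e' (j : 'I_n) := \sum_k invmx G k j *: b k.
have ee' i j : B (b i) (e' j) = (i == j)%:R.
  rewrite (bilin_sumr blB); have /matrixP/(_ i j) := mulmxV Gu; rewrite !mxE => <-.
  have H k : B (b i) (invmx G k j *: b k) = G i k * invmx G k j.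
    by rewrite (bilinZr blB) [G i k]mxE mulrC.
  exact: (eq_bigr _ (fun k _ => H k)).
have be' k : b k = \sum_j G j k *: e' j.
  under eq_bigr => j _ do rewrite scaler_sumr.
  rewrite exchange_big /= (bigD1 k) //= [X in _ + X]big1 ?addr0 => [|l lk].
    rewrite -[LHS]scale1r; have /matrixP/(_ k k) := mulVmx Gu.
    rewrite !mxE eqxx mulr1n => {1}<-; rewrite scaler_suml; apply: eq_bigr => j _.
    by rewrite scalerA mulrC.
  under eq_bigr => j _ do rewrite scalerA mulrC.
  rewrite -scaler_suml; have /matrixP/(_ l k) := mulVmx Gu.
  by rewrite !mxE (negbTE lk) => ->; rewrite scale0r.
exists b, e'; split=> // v; apply/SP => k.
  rewrite be' (bilin_sumr blB) big1 // => j _; rewrite (bilinZr blB).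
  rewrite (bilinBl blB) (bilin_suml blB) (bigD1 j) //= big1 ?addr0 => [|i ij].
    by rewrite (bilinZl blB) ee' eqxx /= [_ *: 1]mulr1 subrr scaler0.
  by rewrite (bilinZl blB) ee' (negbTE ij) scaler0.
rewrite (bilinBl blB) (bilin_suml blB) (bigD1 k) //= big1 ?addr0 => [|i ik].
  by rewrite (bilinZl blB) (symB (e' k)) ee' eqxx [_ *: 1]mulr1 subrr.
by rewrite (bilinZl blB) (symB (e' i)) ee' eq_sym (negbTE ik) scaler0.
Qed.

End DualBases.

Section CasimirTensor.
Variables (F : fieldType) (L : lieAlgType F) (B : L -> L -> F^o).
Hypotheses (blB : bilin B) (symB : forall x y, B x y = B y x).
Hypothesis invB : forall x y z, B (lie x y) z = B x (lie y z).
Variable N : {vspace L}.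
Variables (n : nat) (e e' : 'I_n -> L).
Hypothesis eP : forall v, v - \sum_i (B v (e' i) : F) *: e i \in N.
Hypothesis e'P : forall v, v - \sum_i (B v (e i) : F) *: e' i \in N.

(** Invariance of the Casimir tensor, the sum of [e i] (x) [e' i], tested on a bilinear map instead
    of in the tensor square. The map has to kill [N] in both arguments because the expansions hold
    modulo [N]. *)
Lemma casimir_tensor (W : lmodType F) (f : L -> L -> W) x : bilin f ->
  (forall u v, u \in N -> f u v = 0) -> (forall u v, v \in N -> f u v = 0) ->
  \sum_i f (lie x (e i)) (e' i) = - \sum_i f (e i) (lie x (e' i)).
Proof.
move=> blf fNl fNr.
have El v w : f v w = \sum_j (B v (e' j) : F) *: f (e j) w.
  rewrite -{1}(subrK (\sum_i (B v (e' i) : F) *: e i) v) (bilinDl blf) fNl // add0r.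
  by rewrite (bilin_suml blf); apply: eq_bigr => j _; rewrite (bilinZl blf).
have Er v w : f w v = \sum_j (B v (e j) : F) *: f w (e' j).
  rewrite -{1}(subrK (\sum_i (B v (e i) : F) *: e' i) v) (bilinDr blf) fNr // add0r.
  by rewrite (bilin_sumr blf); apply: eq_bigr => j _; rewrite (bilinZr blf).
under eq_bigr => i _ do rewrite El.
under [in RHS]eq_bigr => i _ do rewrite Er.
rewrite [in RHS]exchange_big -sumrN; apply: eq_bigr => i _ /=.
rewrite -sumrN; apply: eq_bigr => j _; rewrite -scaleNr; congr (_ *: _).
by rewrite lieC (bilinNl blB) invB symB.
Qed.

End CasimirTensor.

Section TraceForm.
Variables (F : fieldType) (L : lieAlgType F) (W : {vspace L}).
Hypothesis IW : ideal W.
Let n := \dim W.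
Let b (i : 'I_n) := (vbasis W)`_i.

Let bW i : b i \in W. Proof. by rewrite vbasis_mem // mem_nth // size_tuple. Qed.

(* The sign makes [admx] a homomorphism, since matrices act on rows. *)
Definition admx (x : L) : 'M[F]_n :=
  \matrix_(i, j) - coord (vbasis W) j (lie x (b i)).

Fact admx_linear : linear admx.
Proof.
move=> a x y; apply/matrixP => i j; rewrite !mxE lieDl lieZl linearD linearZ /=.
by rewrite opprD mulrN.
Qed.
HB.instance Definition _ := GRing.isLinear.Build F L 'M[F]_n _ admx admx_linear.

Definition crow (v : L) : 'rV[F]_n := \row_j coord (vbasis W) j v.

Fact crow_linear : linear crow.
Proof. by move=> a x y; apply/rowP => j; rewrite !mxE linearP. Qed.
HB.instance Definition _ := GRing.isLinear.Build F L 'rV[F]_n _ crow crow_linear.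

Lemma crow_inj v : v \in W -> crow v = 0 -> v = 0.
Proof.
move=> vW v0; rewrite (coord_vbasis vW) big1 // => i _.
by move/rowP/(_ i): v0; rewrite !mxE => ->; rewrite scale0r.
Qed.

Lemma crow_lie x v : v \in W -> crow (lie x v) = - (crow v *m admx x).
Proof.
move=> vW; apply/rowP => j; rewrite !mxE {1}(coord_vbasis vW) linear_sum.
rewrite [LHS]linear_sum -sumrN; apply: eq_bigr => i _ /=.
by rewrite lieZr !mxE linearZ /= mulrN opprK.
Qed.

Lemma crow_b i : crow (b i) = delta_mx 0 i.
Proof.
apply/rowP => j; rewrite !mxE coord_free ?(basis_free (vbasisP W)) //.
by rewrite eqxx eq_sym.
Qed.

Lemma admx_ext (A B : 'M[F]_n) : (forall v, v \in W -> crow v *m A = crow v *m B) -> A = B.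
Proof.
by move=> H; apply/row_matrixP => i; rewrite !rowE -!crow_b H.
Qed.

Lemma admx_lie x y : admx (lie x y) = admx x *m admx y - admx y *m admx x.
Proof.
have IW' u v : v \in W -> lie u v \in W by exact: (elimT (idealP W)).
apply: admx_ext => v vW; apply: oppr_inj; rewrite -crow_lie // mulmxBr !mulmxA.
have E u w : crow v *m admx u *m admx w = crow (lie w (lie u v)).
  by rewrite crow_lie ?IW' // crow_lie // mulNmx opprK.
rewrite !E -linearB -linearN /= opprB; congr crow.
by apply/eqP; rewrite -subr_eq opprK -lie_jacobi.
Qed.

Lemma admx0 x : (forall v, v \in W -> lie x v = 0) -> admx x = 0.
Proof. by move=> x0; apply/matrixP => i j; rewrite !mxE x0 // linear0 oppr0. Qed.

Lemma admx_eq0 x : admx x = 0 -> forall v, v \in W -> lie x v = 0.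
Proof.
move=> x0 v vW; apply: crow_inj; first exact: (elimT (idealP W)).
by rewrite crow_lie // x0 mulmx0 oppr0.
Qed.

Lemma admx_nil x k : admx x ^+ k = 0 -> forall v, v \in W -> iter k (lie x) v = 0.
Proof.
move=> xk v vW; have itW m : iter m (lie x) v \in W.
  by elim: m => //= m IH; exact: (elimT (idealP W)).
apply: crow_inj => //; have -> : crow (iter k (lie x) v) = (-1) ^+ k *: (crow v *m admx x ^+ k).
  elim: {xk} k => [|k IH] /=; first by rewrite !expr0 mulmx1 scale1r.
  rewrite crow_lie // IH (exprSr (admx x)) -[_ * admx x]/(_ *m admx x) mulmxA -scalemxAl.
  by rewrite exprS mulN1r scaleNr.
by rewrite xk mulmx0 scaler0.
Qed.

(** The trace form of the representation of [L] on the ideal [W]; the Killing form when [W] is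
    [fullv]. *)
Definition trform x y : F^o := \tr (admx x *m admx y).

Lemma trform_bilin : bilin trform.
Proof.
split=> [y a u v|x a u v]; rewrite /trform.
  by rewrite linearP /= mulmxDl -scalemxAl linearP.
by rewrite linearP /= mulmxDr -scalemxAr linearP.
Qed.

Lemma trform_sym x y : trform x y = trform y x.
Proof. exact: mxtrace_mulC. Qed.

Lemma trform_inv x y z : trform (lie x y) z = trform x (lie y z).
Proof.
rewrite /trform !admx_lie mulmxBl mulmxBr.
have trB (X Y : 'M[F]_n) : \tr (X - Y) = \tr X - \tr Y by exact: raddfB.
rewrite !trB !mulmxA; congr (_ - _).
by rewrite -[RHS]mxtrace_mulC !mulmxA.
Qed.

(** The sum is the trace of the Casimir operator on [W]. For dual families it is also their number,
    which shows that the operator is nonzero. *)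
Lemma trform_casimir m (e e' : 'I_m -> L) :
  (forall v, v \in W -> \sum_i lie (e i) (lie (e' i) v) = 0) ->
  \sum_i trform (e i) (e' i) = 0.
Proof.
move=> C0; have -> : \sum_i trform (e i) (e' i) = \tr (\sum_i admx (e' i) *m admx (e i)).
  by rewrite linear_sum; apply: eq_bigr => i _; exact: mxtrace_mulC.
suff -> : \sum_i admx (e' i) *m admx (e i) = 0 by rewrite mxtrace0.
have IW' u v : v \in W -> lie u v \in W by exact: (elimT (idealP W)).
apply: admx_ext => v vW; rewrite mulmx0 mulmx_sumr -[RHS](linear0 crow) -(C0 v vW).
rewrite linear_sum; apply: eq_bigr => i _ /=.
by rewrite !crow_lie ?IW' // mulNmx opprK mulmxA.
Qed.

End TraceForm.

(** * Minimal nonsolvable Lie algebras *)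

Lemma vect_ext (F : fieldType) (V : vectType F) (u v : V) :
  (forall i, coord (vbasis {:V}) i u = coord (vbasis {:V}) i v) -> u = v.
Proof.
move=> H; rewrite (coord_vbasis (memvf u)) (coord_vbasis (memvf v)).
by apply: eq_bigr => i _; rewrite H.
Qed.

(** * Quotients, subalgebras and morphisms *)

Section LieQuotient.
Variables (F : fieldType) (L : lieAlgType F) (I : lieIdeal L).

Definition lie_quot : Type := vquot I.
HB.instance Definition _ := Vector.on lie_quot.

Definition lie_quot_proj (x : L) : lie_quot := vproj I x.

Fact lie_quot_proj_linear : linear lie_quot_proj.
Proof. exact: vproj_is_linear. Qed.
HB.instance Definition _ := GRing.isLinear.Build F L lie_quot _ lie_quot_proj
  lie_quot_proj_linear.

Definition lie_quot_lie (p q : lie_quot) : lie_quot :=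
  lie_quot_proj (lie (vrepr p) (vrepr q)).

Lemma lie_quot_surj p : exists x, p = lie_quot_proj x.
Proof. by exists (vrepr p); rewrite /lie_quot_proj vreprK. Qed.

Lemma lie_quot_projM x y :
  lie_quot_lie (lie_quot_proj x) (lie_quot_proj y) = lie_quot_proj (lie x y).
Proof.
have E z : vrepr (lie_quot_proj z) - z \in (I : {vspace L}).
  by rewrite -vproj_eq vreprK.
apply/eqP; rewrite /lie_quot_lie /lie_quot_proj vproj_eq.
rewrite -[lie (vrepr _) _](subrK (lie x (vrepr (lie_quot_proj y)))) -addrA.
rewrite -lieBl -lieBr rpredD //; last exact: lieideal_closed.
by rewrite lieC rpredN lieideal_closed.
Qed.

Fact lie_quot_linearl q : linear (lie_quot_lie^~ q).
Proof.
move=> a u v; have [x ->] := lie_quot_surj u; have [y ->] := lie_quot_surj v.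
have [z ->] := lie_quot_surj q.
by rewrite -linearP !lie_quot_projM lie_linearl linearP.
Qed.
Fact lie_quot_linearr p : linear (lie_quot_lie p).
Proof.
move=> a u v; have [x ->] := lie_quot_surj u; have [y ->] := lie_quot_surj v.
have [z ->] := lie_quot_surj p.
by rewrite -linearP !lie_quot_projM lie_linearr linearP.
Qed.
Fact lie_quotxx p : lie_quot_lie p p = 0.
Proof. by have [x ->] := lie_quot_surj p; rewrite lie_quot_projM liexx linear0. Qed.
Fact lie_quot_jacobi p q r :
  lie_quot_lie p (lie_quot_lie q r) + lie_quot_lie q (lie_quot_lie r p) +
  lie_quot_lie r (lie_quot_lie p q) = 0.
Proof.
have [x ->] := lie_quot_surj p; have [y ->] := lie_quot_surj q.
have [z ->] := lie_quot_surj r.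
by rewrite !lie_quot_projM -!linearD jacobi linear0.
Qed.

HB.instance Definition _ := Vector_isLie.Build F lie_quot
  lie_quot_linearl lie_quot_linearr lie_quotxx lie_quot_jacobi.

End LieQuotient.

Section LieSub.
Variables (F : fieldType) (L : lieAlgType F) (U : {vspace L}).
Hypothesis sU : subalgebra U.

(** The proof that [U] is a subalgebra is an argument of the type, so that the bracket can be
    attached to the type canonically. *)
Definition lie_sub of subalgebra U : Type := subvs_of U.
Local Notation S := (lie_sub sU).
HB.instance Definition _ := Vector.on S.

Definition lie_sub_val (x : S) : L := vsval (x : subvs_of U).

Fact lie_sub_val_linear : linear lie_sub_val. Proof. by []. Qed.
HB.instance Definition _ := GRing.isLinear.Build F S L _ lie_sub_val lie_sub_val_linear.

Lemma lie_sub_val_inj : injective lie_sub_val.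
Proof. exact: val_inj. Qed.

Lemma lie_sub_closed (x y : S) : lie (lie_sub_val x) (lie_sub_val y) \in U.
Proof. by apply: (subvP sU); apply: mem_lie_span; exact: subvsP. Qed.

Definition lie_sub_lie (x y : S) : S := Subvs (lie_sub_closed x y).

Fact lie_sub_linearl y : linear (lie_sub_lie^~ y).
Proof. by move=> a u v; apply/lie_sub_val_inj; rewrite /= lie_linearl. Qed.
Fact lie_sub_linearr x : linear (lie_sub_lie x).
Proof. by move=> a u v; apply/lie_sub_val_inj; rewrite /= lie_linearr. Qed.
Fact lie_subxx x : lie_sub_lie x x = 0.
Proof. by apply/lie_sub_val_inj; rewrite /= liexx. Qed.
Fact lie_sub_jacobi x y z :
  lie_sub_lie x (lie_sub_lie y z) + lie_sub_lie y (lie_sub_lie z x) +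
  lie_sub_lie z (lie_sub_lie x y) = 0.
Proof. by apply/lie_sub_val_inj; rewrite /= jacobi. Qed.

HB.instance Definition _ := Vector_isLie.Build F S
  lie_sub_linearl lie_sub_linearr lie_subxx lie_sub_jacobi.

Lemma lie_sub_valM : {morph lie_sub_val : x y / lie x y >-> lie x y}.
Proof. by []. Qed.

Lemma lie_sub_val_surj v : v \in U -> exists x, lie_sub_val x = v.
Proof. by move=> vU; exists (Subvs vU). Qed.

Lemma lie_sub_limg : limg (linfun lie_sub_val) = U.
Proof.
apply/vspaceP => v; apply/memv_imgP/idP => [[x _ ->]|/lie_sub_val_surj[x <-]].
  by rewrite lfunE; exact: subvsP.
by exists x; rewrite ?memvf ?lfunE.
Qed.

End LieSub.

Section LieMorphism.
Variables (F : fieldType) (M L : lieAlgType F) (phi : {linear M -> L}).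
Hypothesis phiM : {morph phi : x y / lie x y >-> lie x y}.
Local Notation f := (linfun phi).

Lemma limg_lie_span U V : (f @: lie_span U V)%VS = lie_span (f @: U) (f @: V).
Proof.
apply/eqP; rewrite eqEsubv; apply/andP; split.
  apply/subvP => _ /memv_imgP[w wUV ->].
  suff : (lie_span U V <= f @^-1: lie_span (f @: U) (f @: V))%VS.
    by move/subvP/(_ w wUV); rewrite -memv_preim.
  apply/lie_span_subP => u v uU vV; rewrite -memv_preim lfunE /= phiM.
  by rewrite -!(lfunE phi) mem_lie_span ?memv_img.
apply/lie_span_subP => _ _ /memv_imgP[u uU ->] /memv_imgP[v vV ->].
by rewrite !lfunE -phiM -lfunE memv_img ?mem_lie_span.
Qed.

Lemma limg_derived_iter n U : (f @: derived_iter n U)%VS = derived_iter n (f @: U)%VS.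
Proof. by elim: n => //= n IH; rewrite limg_lie_span IH. Qed.

Lemma solvable_limg U : solvable U -> solvable (f @: U)%VS.
Proof. by move=> [n Un]; exists n; rewrite -limg_derived_iter Un limg0. Qed.

Lemma solvable_limg_inj U : injective phi -> solvable (f @: U)%VS -> solvable U.
Proof.
move=> phi_inj [n Un]; exists n; apply/eqP; rewrite -subv0.
have kf : lker f == 0%VS by apply/lker0P => x y; rewrite !lfunE; exact: phi_inj.
by rewrite -(limg_ker0 _ _ kf) limg_derived_iter Un limg0 subvv.
Qed.

Lemma lpreim_subalgebra U : subalgebra U -> subalgebra (f @^-1: U)%VS.
Proof.
move=> /lie_span_subP sU; apply/lie_span_subP => u v.
by rewrite -!memv_preim !lfunE /= phiM; exact: sU.
Qed.

Lemma limg_ideal U : limg f = fullv -> ideal U -> ideal (f @: U)%VS.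
Proof.
move=> fS IU; rewrite /ideal -{1}fS -limg_lie_span; exact: limgS.
Qed.

Lemma lker_ideal : ideal (lker f).
Proof.
apply/idealP => x y; rewrite !memv_ker !lfunE /= phiM => /eqP->.
by rewrite lie0r.
Qed.

End LieMorphism.

(** * First properties of minimal nonsolvable algebras *)

Section MinimalNonsolvable.
Variables (F : fieldType).

Definition min_nonsolvable (L : lieAlgType F) :=
  ~ solvable (fullv : {vspace L}) /\
  forall U : {vspace L}, subalgebra U -> U <> fullv -> solvable U.

(** The kernel is a proper ideal, hence solvable, so a solvable [Q] would make [L] solvable. Proper
    subalgebras of [Q] are images of their preimages, which are proper too. *)
Lemma min_nonsolvable_quot (L Q : lieAlgType F) (phi : {linear L -> Q}) :
  {morph phi : x y / lie x y >-> lie x y} -> limg (linfun phi) = fullv ->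
  lker (linfun phi) <> fullv -> min_nonsolvable L -> min_nonsolvable Q.
Proof.
move=> phiM phiS phiK [nL mL]; split=> [[n Qn]|U sU nU].
  apply: nL; have [m km] : solvable (lker (linfun phi)).
    by apply: mL => //; exact/ideal_subalgebra/lker_ideal.
  exists (m + n)%N; rewrite derived_iterD; apply/eqP; rewrite -subv0 -km.
  by apply: derived_iterS; rewrite lkerE limg_derived_iter // phiS Qn.
have UE : (linfun phi @: (linfun phi @^-1: U))%VS = U by rewrite lpreimK // phiS subvf.
rewrite -UE; apply: solvable_limg => //; apply: mL; first exact: lpreim_subalgebra.
by move=> pE; apply: nU; rewrite -UE pE.
Qed.

Variable (L : lieAlgType F).
Hypothesis mL : min_nonsolvable L.

Lemma min_nonsolvable_perfect : derived_algebra L = fullv.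
Proof.
apply/eqP/negPn/negP => /eqP nD; apply: mL.1; apply: solvable_lie_span.
by apply: mL.2 nD; exact/lie_spanS/subvf/subvf.
Qed.

(** Both summands are solvable, hence so would be their sum. This rules out complements of proper
    ideals. *)
Lemma min_nonsolvable_add (U V : {vspace L}) : subalgebra U -> U <> fullv ->
  ideal V -> V <> fullv -> (U + V)%VS <> fullv.
Proof.
move=> sU nU IV nV UV; apply: mL.1; rewrite -UV; apply: solvable_ideal_add => //.
  exact: mL.2.
exact: mL.2 (ideal_subalgebra IV) nV.
Qed.

Lemma min_nonsolvable_not_nil (U : {vspace L}) : ideal U -> U <> fullv ->
  ~ forall x, exists n, forall y, iter n (lie x) y \in U.
Proof.
move=> IU nU nil; have [K nK] := engel_derived IU nil nU.
rewrite min_nonsolvable_perfect => KL; apply: nK; apply/eqP.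
by rewrite eqEsubv subvf.
Qed.

Lemma ideal_lie_span (U V : {vspace L}) : ideal U -> ideal V -> ideal (lie_span U V).
Proof.
move=> /idealP IU /idealP IV; apply/idealP => x y yUV.
suff : (lie_span U V <= linfun (lie x) @^-1: lie_span U V)%VS.
  by move/subvP/(_ y yUV); rewrite -memv_preim lfunE.
apply/lie_span_subP => u v uU vV; rewrite -memv_preim lfunE /= lie_jacobi.
by rewrite rpredD // mem_lie_span ?IU ?IV.
Qed.

End MinimalNonsolvable.

(** Each commutator puts one more factor [A] to the left or to the right of [X]; after [k] of them
    one side has at least [n] factors. *)
Lemma iter_commutator_nil (R : pzRingType) (A : R) n k i j (X : R) :
  A ^+ n = 0 -> (n + n <= i + j + k)%N ->
  iter k (fun Y => A * Y - Y * A) (A ^+ i * X * A ^+ j) = 0.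
Proof.
move=> An; have A0 m : (n <= m)%N -> A ^+ m = 0.
  by move=> nm; rewrite -(subnK nm) exprD An mulr0.
set ad := fun Y => _; have adB m Y Z : iter m ad (Y - Z) = iter m ad Y - iter m ad Z.
  elim: m => //= m ->; rewrite /ad mulrBr mulrBl !opprB addrACA [X in _ + X]addrC.
  by rewrite addrACA.
elim: k i j => [|k IH] i j ijk.
  case: (leqP n i) => ni; first by rewrite /= A0 ?mul0r.
  by rewrite /= [X in _ * X]A0 ?mulr0 //; lia.
rewrite iterSr /ad -/ad !mulrA -exprS -[_ * A ^+ j * A]mulrA -exprSr adB.
by rewrite !IH ?subrr //; lia.
Qed.

Section TraceRadical.
Variables (R : rcfType) (L : lieAlgType R).
Hypothesis mL : min_nonsolvable L.

Lemma trform_nil (W : {vspace L}) : ideal W -> (forall x y, trform W x y = 0) ->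
  forall x, exists k, admx W x ^+ k = 0.
Proof.
move=> IW tr0 x; apply: (cartan_nilpotent (rho := admx W)) => //; first exact: admx_lie.
by rewrite min_nonsolvable_perfect ?memvf.
Qed.

(** If the Killing form vanished, every [lie x] would be nilpotent by Cartan's criterion, and
    Engel's theorem would contradict perfectness. *)
Lemma trform_full_neq0 : ~ forall x y, trform (fullv : {vspace L}) x y = 0.
Proof.
have If : ideal (fullv : {vspace L}) by apply/idealP => x y _; exact: memvf.
move=> tr0; apply: (@min_nonsolvable_not_nil _ _ mL 0%VS).
- by apply/idealP => x y; rewrite memv0 => /eqP->; rewrite lie0r mem0v.
- by move=> E; apply: mL.1; exists 0.
- move=> x; have [k xk] := trform_nil If tr0 x; exists k => y.
  by rewrite (admx_nil If xk) ?mem0v ?memvf.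
Qed.

Lemma trform_radical_ideal (W N : {vspace L}) : ideal W ->
  (forall v, v \in N <-> forall w, trform W v w = 0) -> ideal N.
Proof.
move=> IW NP; apply/idealP => x y /NP y0; apply/NP => w.
have blB := trform_bilin W.
by rewrite lieC (bilinNl blB) (trform_inv IW) y0 oppr0.
Qed.

End TraceRadical.

(* An operator on all of L, even when e and e' are dual families for the trace
   form of a proper ideal. *)
Definition casimir (F : fieldType) (L : lieAlgType F) n (e e' : 'I_n -> L) (v : L) : L :=
  \sum_i lie (e i) (lie (e' i) v).

Section Casimir.
Variables (F : fieldType) (L : lieAlgType F) (n : nat) (e e' : 'I_n -> L).

Fact casimir_linear : linear (casimir e e').
Proof.
move=> a u v; rewrite /casimir scaler_sumr -big_split; apply: eq_bigr => i _ /=.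
by rewrite !lie_linearr.
Qed.
HB.instance Definition _ := GRing.isLinear.Build F L L _ (casimir e e') casimir_linear.

Variables (B : L -> L -> F^o) (N : {vspace L}).
Hypotheses (blB : bilin B) (symB : forall x y, B x y = B y x).
Hypothesis invB : forall x y z, B (lie x y) z = B x (lie y z).
Hypothesis eP : forall v, v - \sum_i (B v (e' i) : F) *: e i \in N.
Hypothesis e'P : forall v, v - \sum_i (B v (e i) : F) *: e' i \in N.

(** [casimir_tensor] for f u w = [u, [w, v]]. The conditions on [N] concern the single vector [v],
    so that they can be checked on an ideal only. *)
Lemma casimir_lie x v : (forall u w, u \in N -> lie u (lie w v) = 0) ->
  (forall u, u \in N -> lie u v = 0) ->
  casimir e e' (lie x v) = lie x (casimir e e' v).
Proof.
move=> N1 N2; pose f u w := lie u (lie w v).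
have blf : bilin f.
  by split=> [w a y z|y a w z]; rewrite /f !lie_linearl ?lie_linearr.
have H := casimir_tensor blB symB invB eP e'P x blf.
rewrite /casimir linear_sum /=.
under [RHS]eq_bigr => i _ do rewrite lie_jacobi (lie_jacobi x (e' i)) lieDr.
rewrite !big_split /= {}H => [|u w uN|u w wN]; rewrite /f; first last.
- by rewrite N2 ?lie0r.
- exact: N1.
- by rewrite addrA addNr add0r.
Qed.

End Casimir.

Lemma lieNl (F : fieldType) (L : lieAlgType F) (x y : L) : lie (- x) y = - lie x y.
Proof. exact: bilinNl (bilin_lie L) x y. Qed.

Section Coord.
Variables (F : fieldType) (V : vectType F) (n : nat) (X : n.-tuple V) (i : 'I_n).
Lemma coordD u v : coord X i (u + v) = coord X i u + coord X i v.
Proof. exact: linearD. Qed.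
Lemma coordN u : coord X i (- u) = - coord X i u.
Proof. exact: linearN. Qed.
Lemma coordZ a u : coord X i (a *: u) = a * coord X i u.
Proof. exact: linearZ. Qed.
End Coord.

(* Decides linear identities between brackets, treating each bracket and each
   value of a linear map as an atom. *)
Ltac vect_ring :=
  rewrite ?(lieDl, lieDr, lieNl, lieNr, lieZl, lieZr);
  repeat match goal with |- context [lie ?a ?b] => move: (lie a b) => ? end;
  repeat match goal with |- context [fun_of_lfun ?f ?a] => move: (f a) => ? end;
  let i := fresh in apply: vect_ext => i; rewrite ?(coordD, coordN, coordZ); ring.

(** * Simplicity by means of Casimir operators *)

Section Simple.
Variables (R : rcfType) (L : lieAlgType R).
Hypothesis mL : min_nonsolvable L.

(** If the Casimir operator vanished on [W], so would its trace, which is the codimension of [N] by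
    duality; then the trace form would be 0. *)
Lemma trform_casimir_exists (W : {vspace L}) : ideal W ->
  ~ (forall x y, trform W x y = 0) ->
  exists (N : {vspace L}) (n : nat) (e e' : 'I_n -> L),
  [/\ [/\ ideal N, N <> fullv & forall v, v \in N <-> forall w, trform W v w = 0],
      forall v, v - \sum_i (trform W v (e' i) : R) *: e i \in N,
      forall v, v - \sum_i (trform W v (e i) : R) *: e' i \in N &
      exists2 v, v \in W & casimir e e' v != 0].
Proof.
move=> IW nB; have blB := trform_bilin W; have symB := trform_sym W.
have [N NP] := radical_exists blB.
have [e [e' [ee' eP e'P]]] := dual_bases blB symB NP.
have nN : N <> fullv.
  by move=> NE; apply: nB => x y; move: y; apply/NP; rewrite NE memvf.
exists N, _, e, e'; split=> //; first by split=> //; exact: trform_radical_ideal NP.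
apply: contrapT => C0; have : \sum_i trform W (e i) (e' i) = 0.
  apply: trform_casimir => // v vW; apply/eqP/negPn/negP => Cv; apply: C0.
  by exists v.
under eq_bigr => i _ do rewrite ee' eqxx.
rewrite sumr_const card_ord => /eqP; rewrite -mulr_natr mul1r pnatr_eq0 subn_eq0.
move=> dN; apply: nN; apply/eqP; by rewrite eqEdim subvf.
Qed.

Section MinimalIdeal.
Variable M : {vspace L}.
Hypotheses (IM : ideal M) (M0 : M <> 0%VS) (MT : M <> fullv).
Hypothesis Mmin : forall J, ideal J -> (J <= M)%VS -> J = 0%VS \/ J = M.
Hypothesis Mmax : forall J, ideal J -> (M <= J)%VS -> J = M \/ J = fullv.

(** [M, M] is 0 or [M] by minimality, and [M] is excluded because [M] is solvable and nonzero. *)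
Lemma minimal_ideal_abelian x y : x \in M -> y \in M -> lie x y = 0.
Proof.
move=> xM yM; have [n Mn] := mL.2 M (ideal_subalgebra IM) MT.
have [|E|E] := Mmin (ideal_lie_span IM IM).
- exact: ideal_subalgebra.
- by apply/eqP; rewrite -memv0 -E mem_lie_span.
- case: M0; rewrite -Mn; elim: {Mn} n => //= n IH.
  by rewrite /derived_iter /= -/(derived_iter n M) -IH E.
Qed.

(** If [M] were central, it would be both the radical of the Killing form and the kernel of its
    Casimir operator [c], whose image is a proper ideal. By maximality im c + M is [L], which
    [min_nonsolvable_add] excludes, or [M]; then c [x, y] = [x, c y] = 0, so L = [L, L] lies in ker
    c = M. *)
Lemma minimal_ideal_not_central : ~ forall x m, m \in M -> lie x m = 0.
Proof.
move=> cen; have If : ideal (fullv : {vspace L}) by apply/idealP => x y _; exact: memvf.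
have cen' m x : m \in M -> lie m x = 0 by move=> mM; rewrite lieC cen ?oppr0.
have [N [n [e [e' [[IN nN NP] eP e'P [v0 _ Cv0]]]]]] :=
  trform_casimir_exists If (trform_full_neq0 mL).
have NM : N = M.
  case: (Mmax IN) => [|//|//].
  apply/subvP => m mM; apply/NP => w; rewrite /trform admx0 ?mul0mx ?mxtrace0 //.
  by move=> v _; exact: cen'.
pose c := linfun (casimir e e').
have cE v : c v = casimir e e' v by rewrite lfunE.
have comm x v : c (lie x v) = lie x (c v).
  rewrite !cE; apply: (casimir_lie (trform_bilin _) (trform_sym _) (trform_inv If) eP e'P).
    by move=> u w; rewrite NM => uM; exact: cen'.
  by move=> u; rewrite NM => uM; exact: cen'.
have kerc : lker c = M.
  case: (@Mmax (lker c)) => //.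
  - by apply/idealP => x y; rewrite !memv_ker comm => /eqP->; rewrite lie0r.
  - apply/subvP => m mM; rewrite memv_ker cE /casimir big1 // => i _.
    by rewrite (cen (e' i)) // lie0r.
  - move=> E; have := memvf v0; rewrite -E memv_ker cE; by rewrite (negbTE Cv0).
have Ic : ideal (limg c).
  by apply/idealP => x _ /memv_imgP[v _ ->]; rewrite -comm memv_img ?memvf.
have cT : limg c <> fullv.
  move=> E; have := limg_ker_dim c fullv; rewrite capfv kerc E => dE.
  by apply: M0; apply/eqP; rewrite -dimv_eq0; apply/eqP; lia.
have Ics : ideal (limg c + M)%VS.
  apply/idealP => x _ /memv_addP[u uc [m mM ->]]; rewrite lieDr memv_add //.
    exact: (elimT (idealP _) Ic).
  exact: (elimT (idealP _) IM).
case: (Mmax Ics (addvSr _ _)) => [cM|]; last first.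
  exact: min_nonsolvable_add (ideal_subalgebra Ic) cT IM MT.
apply: MT; apply/eqP; rewrite eqEsubv subvf -(min_nonsolvable_perfect mL).
apply/lie_span_subP => x y _ _; rewrite -kerc memv_ker comm cen //.
by rewrite -cM (subvP (addvSl _ _)) ?memv_img ?memvf.
Qed.

(** If the form vanished, every [x] would act nilpotently on [M] by Cartan's criterion, so [lie x]
    would be nilpotent modulo the annihilator [J] of [M]. But [J] contains the abelian ideal [M] and
    is proper, so J = M, and Engel's theorem gives a contradiction. *)
Lemma minimal_ideal_radical_form : ~ forall x y, trform M x y = 0.
Proof.
move=> tr0; pose A x := forall v, v \in M -> lie x v = 0.
have [J JP] : exists J : {vspace L}, forall x, x \in J <-> A x.
  apply: vspace_of_pred => [v _|a u w Au Aw v vM]; first exact: lie0l.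
  by rewrite lieDl lieZl Au ?Aw // scaler0 addr0.
have IJ : ideal J.
  apply/idealP => x y /JP Ay; apply/JP => v vM.
  have /eqP := lie_jacobi x y v; rewrite Ay // lie0r Ay ?(elimT (idealP M)) // addr0 eq_sym.
  by move=> /eqP.
have JM : J = M.
  case: (Mmax IJ) => // [|JT].
    by apply/subvP => m mM; apply/JP => v vM; exact: minimal_ideal_abelian.
  case: minimal_ideal_not_central => x m mM.
  by move: m mM; apply/JP; rewrite JT memvf.
apply: (min_nonsolvable_not_nil mL IM MT) => x.
have [k xk] := trform_nil mL IM tr0 x; exists (k + k)%N => y.
rewrite -JM; apply/JP; apply: (admx_eq0 IM).
have := @iter_commutator_nil _ _ _ (k + k) 0 0 (admx M y) xk (leqnn _).
rewrite !expr0 mul1r mulr1 => <-.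
by elim: (k + k)%N => //= m <-; rewrite admx_lie.
Qed.

(** The extension of L/M by the abelian ideal [M] is split as in Whitehead's second lemma. The
    Casimir operator [c] is invertible on [M], and the projection [p] onto [M] is corrected to a
    1-cocycle [P] with values in [M] that is still the identity on [M]. The kernel of [P] is then a
    subalgebra complementary to [M]. *)
Lemma minimal_ideal_absurd : False.
Proof.
have [N [n [e [e' [[IN nN NP] eP e'P [v0 v0M Cv0]]]]]] :=
  trform_casimir_exists IM minimal_ideal_radical_form.
have IM' x v : v \in M -> lie x v \in M by exact: (elimT (idealP M)).
have abM := minimal_ideal_abelian.
have NM : N = M.
  case: (Mmax IN) => [|//|//].
  apply/subvP => m mM; apply/NP => w; rewrite /trform admx0 ?mul0mx ?mxtrace0 //.
  by move=> v vM; exact: abM.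
rewrite {}NM in eP e'P NP.
pose c := linfun (casimir e e').
have cE v : c v = casimir e e' v by rewrite lfunE.
have cM v : v \in M -> c v \in M.
  by move=> vM; rewrite cE; apply: rpred_sum => i _; rewrite !IM'.
have comm x v : v \in M -> c (lie x v) = lie x (c v).
  move=> vM; rewrite !cE.
  apply: (casimir_lie (trform_bilin _) (trform_sym _) (trform_inv IM) eP e'P).
    by move=> u w uM; rewrite abM // IM'.
  by move=> u uM; rewrite abM.
have c_inj v : v \in M -> c v = 0 -> v = 0.
  move=> vM cv; have IK : ideal (M :&: lker c)%VS.
    apply/idealP => x y; rewrite !memv_cap !memv_ker => /andP[yM /eqP y0].
    by rewrite IM' // comm // y0 lie0r eqxx.
  case: (Mmin IK (capvSl _ _)) => E.
    by apply/eqP; rewrite -memv0 -E memv_cap vM memv_ker cv eqxx.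
  by move: v0M; rewrite -E memv_cap memv_ker cE (negbTE Cv0) andbF.
(* [h] extends the Casimir operator from M to L by the identity of M^C, so that
   its inverse is a linear map on L. *)
pose p := projv M.
have pM x : p x \in M by exact: memv_proj.
have pid m : m \in M -> p m = m by exact: projv_id.
pose h : 'End(L) := (c \o p + (\1 - p))%VF.
have hE v : h v = c (p v) + (v - p v).
  by rewrite !add_lfunE comp_lfunE opp_lfunE id_lfunE.
have h_inj : lker h == 0%VS.
  rewrite -subv0; apply/subvP => v; rewrite memv_ker memv0 hE => /eqP hv.
  have E : c (p v) = 0.
    apply/eqP; rewrite -memv0 -(capv_compl M) memv_cap cM //=.
    by rewrite -[c _]opprK rpredN (_ : - c _ = v - p v) ?memv_projC // -(addr0_eq hv).
  by move: hv; rewrite E add0r (c_inj _ (pM v) E) subr0 => ->.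
pose D := (h^-1)%VF.
have hM m : m \in M -> h m = c m by move=> mM; rewrite hE pid // subrr addr0.
have hMM : (h @: M)%VS = M.
  apply/eqP; rewrite eqEdim limg_dim_eq ?leqnn ?andbT; last first.
    by rewrite (eqP h_inj) capv0.
  by apply/subvP => _ /memv_imgP[m mM ->]; rewrite hM // cM.
have Dc m : m \in M -> D (c m) = m by move=> mM; rewrite -hM // lker0_lfunK.
have DM m : m \in M -> D m \in M /\ c (D m) = m.
  by rewrite -{1}hMM => /memv_imgP[m' m'M ->]; rewrite /D lker0_lfunK // hM.
have Dlie x m : m \in M -> lie x (D m) = D (lie x m).
  by move=> mM; have [DmM cDm] := DM m mM; rewrite -{2}cDm -comm // Dc ?IM'.
(* The coboundary of [p], which measures its failure to be a 1-cocycle. It vanishes when an argument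
   lies in [M], so it descends to L/M. *)
pose om x y := lie x (p y) - lie y (p x) - p (lie x y).
have omM x y : om x y \in M by rewrite !rpredB ?IM'.
have omC x y : om x y = - om y x.
  rewrite /om (lieC y x) linearN /=.
  by vect_ring.
have om0 x y : x \in M -> om x y = 0.
  move=> xM; rewrite /om abM // sub0r (pid x) // pid ?ideal_liel // (lieC y) opprK.
  exact: subrr.
have om_lin x : linear (om x).
  move=> a u v; rewrite /om lie_linearr lie_linearl !(linearP p) /= lie_linearr.
  by vect_ring.
have om_bilin : bilin om.
  split=> [y a u v|]; last exact: om_lin.
  by rewrite /= (omC _ y) (omC u) (omC v) om_lin opprD scalerN.
(* The homotopy attached to the Casimir tensor, applied to [om]. *)
pose chi y := \sum_i lie (e i) (om (e' i) y).
have chiM y : chi y \in M by apply: rpred_sum => i _; rewrite IM'.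
have chi_lin : linear chi.
  move=> a u v; rewrite /chi scaler_sumr -big_split; apply: eq_bigr => i _ /=.
  by rewrite om_lin lie_linearr.
have chi0 m : m \in M -> chi m = 0.
  by move=> mM; rewrite /chi big1 // => i _; rewrite omC om0 // oppr0 lie0r.
have lie_chi x y : lie x (chi y) =
    \sum_i lie (e i) (lie x (om (e' i) y) - om (lie x (e' i)) y).
  pose f u w := lie u (om w y).
  have blf : bilin f.
    split=> [w a u z|u a w z]; rewrite /f ?lie_linearl //.
    by rewrite om_bilin.1 lie_linearr.
  have H := casimir_tensor (trform_bilin _) (trform_sym _) (trform_inv IM) eP e'P x blf.
  rewrite /chi linear_sum /=; under eq_bigr => i _ do rewrite lie_jacobi.
  rewrite big_split /= {}H => [|u w uM|u w wM]; rewrite /f; first last.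
  - by rewrite om0 ?lie0r.
  - by rewrite abM.
  - by rewrite addrC -sumrB; apply: eq_bigr => i _; rewrite lieBr.
(* The coboundary of [chi] is [c] applied to [om], so that p - c^-1 chi is a cocycle. *)
have d_chi x y : lie x (chi y) - lie y (chi x) - chi (lie x y) = c (om x y).
  rewrite !lie_chi cE /casimir /chi -!sumrB; apply: eq_bigr => i _.
  rewrite -!lieBr; congr (lie _ _); move: (e' i) => z; rewrite /om.
  rewrite !lieBr (lie_jacobi x z) (lie_jacobi y z) (lie_jacobi x y (p z)).
  have E1 : lie z (lie x y) = lie (lie y z) x - lie (lie x z) y.
    rewrite (lie_jacobi z x y) addrC (lieC x (lie z y)) (lieC z y) (lieC z x).
    by rewrite !(bilinNl (bilin_lie L)) opprK.
  rewrite E1 (lieC z y) (lieC z x) (linearB p) !(linearN p) /=.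
  by vect_ring.
pose P v := p v - D (chi v).
have P_lin : linear P.
  move=> a u v; rewrite /P chi_lin (linearP p) (linearP D) /=.
  by vect_ring.
have PM v : P v \in M by rewrite rpredB // (DM _ (chiM v)).1.
have Pid m : m \in M -> P m = m by move=> mM; rewrite /P pid // chi0 // linear0 subr0.
have P_lie x y : P (lie x y) = lie x (P y) - lie y (P x).
  rewrite /P !lieBr !Dlie //.
  have E := congr1 D (d_chi x y); rewrite (Dc _ (omM x y)) !linearB /= in E.
  have -> : p (lie x y) = lie x (p y) - lie y (p x) - om x y by rewrite /om subKr.
  rewrite -E.
  by vect_ring.
pose Pl : {linear L -> L} := HB.pack P (GRing.isLinear.Build _ _ _ _ P P_lin).
pose K := lker (linfun Pl).
have KE v : (v \in K) = (P v == 0) by rewrite memv_ker lfunE.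
have sK : subalgebra K.
  apply/lie_span_subP => u v; rewrite !KE P_lie => /eqP-> /eqP->.
  by rewrite !lie0r subr0.
apply: (min_nonsolvable_add mL sK _ IM MT).
  move=> KT; apply: M0; apply/eqP; rewrite -subv0; apply/subvP => m mM.
  by have := memvf m; rewrite -KT KE Pid // memv0.
apply/eqP; rewrite eqEsubv subvf; apply/subvP => v _.
rewrite -(subrK (P v) v) memv_add // KE.
have -> : P (v - P v) = P v - P (P v) by exact: (linearB Pl).
by rewrite (Pid (P v)) // subrr.
Qed.

End MinimalIdeal.
End Simple.

(** Induction on the dimension: the quotient by a minimal nonzero ideal [M] is again minimal
    nonsolvable, hence has no proper nonzero ideal. So [M] is maximal as well, and
    [minimal_ideal_absurd] applies. *)
Theorem min_nonsolvable_simple (R : rcfType) (L : lieAlgType R) (I : {vspace L}) :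
  min_nonsolvable L -> ideal I -> I = 0%VS \/ I = fullv.
Proof.
have [d] := ubnP (\dim {:L}); elim: d L I => // d IH L I dL mL II.
apply: contrapT => /not_orP[I0 IT].
have [M [[IM M0] MI Mmin']] := min_vspace (conj II I0 : (fun J => ideal J /\ J <> 0%VS) I).
have MT : M <> fullv by move=> ME; apply: IT; apply/eqP; rewrite eqEsubv subvf -ME.
have Mmin J : ideal J -> (J <= M)%VS -> J = 0%VS \/ J = M.
  by move=> IJ JM; have [->|/eqP J0] := eqVneq J 0%VS; [left | right; exact: Mmin'].
apply: (minimal_ideal_absurd mL IM M0 MT Mmin) => J IJ MJ.
pose M' : lieIdeal L := LieIdeal (elimT (idealP M) IM).
pose q := linfun (@lie_quot_proj _ _ M').
have qM : {morph @lie_quot_proj _ _ M' : x y / lie x y >-> lie x y}.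
  by move=> x y; rewrite -lie_quot_projM.
have qS : limg q = fullv.
  apply/eqP; rewrite eqEsubv subvf; apply/subvP => y _.
  by have [x ->] := lie_quot_surj y; rewrite -lfunE memv_img ?memvf.
have qK : lker q = M.
  by apply/vspaceP => v; rewrite memv_ker lfunE; exact: vproj_eq0.
have mQ : min_nonsolvable (lie_quot M').
  by apply: (min_nonsolvable_quot qM qS) => //; rewrite qK.
have dQ : (\dim {:lie_quot M'} < d)%N.
  have := limg_ker_dim q fullv; rewrite capfv qK qS => dE.
  have M_gt0 : (0 < \dim M)%N by rewrite lt0n dimv_eq0; apply/eqP.
  by rewrite -ltnS; apply: leq_trans dL; rewrite ltnS -dE -[X in (X < _)%N]add0n ltn_add2r.
case: (IH _ (q @: J)%VS dQ mQ (limg_ideal qM qS IJ)) => [/eqP|] E.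
  by left; apply/eqP; rewrite eqEsubv MJ andbT -qK lkerE.
right; apply/eqP; rewrite eqEsubv subvf; apply/subvP => x _.
have : q x \in (q @: J)%VS by rewrite E memvf.
move=> /memv_imgP[y yJ xy]; rewrite -(subrK y x) rpredD // (subvP MJ) // -qK.
by rewrite memv_ker linearB /= xy subrr.
Qed.

(** * Third cohomology of nonsolvable Lie algebras *)

Lemma min_nonsolvable_exists (F : fieldType) (L : lieAlgType F) :
  ~ solvable (fullv : {vspace L}) ->
  exists (M : lieAlgType F) (phi : {linear M -> L}),
  [/\ {morph phi : x y / lie x y >-> lie x y}, injective phi & min_nonsolvable M].
Proof.
move=> nL; have sf : subalgebra (fullv : {vspace L}) by exact: subvf.
have [U [[sU nU] _ Umin]] :=
  min_vspace (conj sf nL : (fun U => subalgebra U /\ ~ solvable U) fullv).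
exists (lie_sub sU), (@lie_sub_val _ _ _ sU); split.
- exact: lie_sub_valM.
- exact: lie_sub_val_inj.
split=> [/(solvable_limg (@lie_sub_valM _ _ _ sU))|V sV nV]; first by rewrite lie_sub_limg.
apply: contrapT => nsV; apply: nV.
have VU : (linfun (@lie_sub_val _ _ _ sU) @: V <= U)%VS.
  by apply: subv_trans (limgS _ (subvf V)) _; rewrite lie_sub_limg.
have VE : (linfun (@lie_sub_val _ _ _ sU) @: V)%VS = U.
  apply: Umin => //; split.
    by rewrite /subalgebra -limg_lie_span // limgS.
  by move=> /(solvable_limg_inj (@lie_sub_valM _ _ _ sU) (@lie_sub_val_inj _ _ _ sU)).
apply/eqP; rewrite -(eq_limg_ker0 (f := linfun (@lie_sub_val _ _ _ sU))).
  by rewrite lie_sub_limg VE.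
by apply/lker0P => x y; rewrite !lfunE; exact: lie_sub_val_inj.
Qed.

Section WhiteheadOne.
Variables (R : rcfType) (L : lieAlgType R).
Hypothesis mL : min_nonsolvable L.

(** Whitehead's first lemma: [f] is a 1-cocycle with values in the coadjoint module, and the Casimir
    homotopy [xi] satisfies xi [u, z] = f u (c z). As [c] is invertible and commutes with brackets,
    f x x = xi [x, c^-1 x] = xi (c^-1 [x, x]) = 0. *)
Lemma min_nonsolvable_cocycle (f : L -> L -> R^o) : bilin f ->
  (forall x y z, f (lie x y) z = f x (lie y z) - f y (lie x z)) ->
  forall x, f x x = 0.
Proof.
move=> blf fP x; have If : ideal (fullv : {vspace L}) by exact: subvf.
have [N [n [e [e' [[IN nN NP] eP e'P [v0 _ Cv0]]]]]] :=
  trform_casimir_exists If (trform_full_neq0 mL).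
case: (min_nonsolvable_simple mL IN) => // NE; rewrite {}NE {nN IN NP} in eP e'P.
have z0 u : u \in (0%VS : {vspace L}) -> u = 0 by rewrite memv0 => /eqP.
have blT := trform_bilin (fullv : {vspace L}).
have symT := trform_sym (fullv : {vspace L}).
have invT := trform_inv If.
pose c := linfun (casimir e e').
have comm u v : c (lie u v) = lie u (c v).
  rewrite !lfunE; apply: (casimir_lie blT symT invT eP e'P).
    by move=> a w /z0->; rewrite lie0l.
  by move=> a /z0->; rewrite lie0l.
have kc : lker c == 0%VS.
  case: (min_nonsolvable_simple mL (I := lker c)) => [|->//|E].
    by apply/idealP => a b; rewrite !memv_ker comm => /eqP->; rewrite lie0r.
  by have := memvf v0; rewrite -E memv_ker lfunE /= (negbTE Cv0).
pose xi z := \sum_i f (e i) (lie (e' i) z).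
have xiE u z : xi (lie u z) = f u (c z).
  pose h a b := f a (lie b z).
  have blh : bilin h.
    split=> [b k s t|a k s t]; rewrite /h ?lie_linearl.
      by rewrite blf.1.
    by rewrite blf.2.
  have H := casimir_tensor blT symT invT eP e'P u blh.
  rewrite lfunE /= /casimir (bilin_sumr blf) /xi.
  under eq_bigr => i _ do rewrite lie_jacobi (bilinDr blf).
  rewrite big_split /=.
  have -> : \sum_i f (e i) (lie u (lie (e' i) z)) =
      \sum_i f u (lie (e i) (lie (e' i) z)) - \sum_i h (lie u (e i)) (e' i).
    by rewrite -sumrB; apply: eq_bigr => i _; rewrite /h fP opprB addrC subrK.
  rewrite H => [|a b aM|a b bM]; rewrite ?opprK.
  - rewrite [RHS](_ : _ = \sum_i f u (lie (e i) (lie (e' i) z))) //.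
    rewrite addrCA -[RHS]addr0; congr (_ + _).
    rewrite -big_split big1 // => i _ /=.
    by rewrite /h (lieC u) lieNl (bilinNr blf) subrr.
  - by rewrite (z0 _ aM) /h (bilin0l blf).
  - by rewrite (z0 _ bM) /h lie0l (bilin0r blf).
have -> : f x x = f x (c (c^-1%VF x)) by rewrite lker0_lfunVK.
rewrite -xiE; have -> : lie x (c^-1%VF x) = 0.
  move/lker0P: (kc) => c_inj; apply: c_inj; rewrite linear0 comm lker0_lfunVK //; exact: liexx.
by rewrite /xi big1 // => i _; rewrite lie0r (bilin0r blf).
Qed.

End WhiteheadOne.

(** On a minimal nonsolvable subalgebra [M] the form [f] below is alternating, and [b] is too, so
    the Killing form of [L] vanishes on [M]. Cartan's criterion is applied to [M] acting on all of
    [L]; Engel's theorem for [M] ends the argument. *)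
Lemma killing_not_exact (R : rcfType) (L : lieAlgType R) (b : L -> L -> R^o) :
  bilin b -> (forall x, b x x = 0) ->
  (forall x y z, trform fullv (lie x y) z =
     b (lie x y) z + b (lie y z) x + b (lie z x) y) ->
  solvable (fullv : {vspace L}).
Proof.
move=> blb b0 bE; apply: contrapT => /min_nonsolvable_exists[M [phi [phiM phi_inj mM]]].
have If : ideal (fullv : {vspace L}) by exact: subvf.
have blT := trform_bilin (fullv : {vspace L}).
have symT := trform_sym (fullv : {vspace L}).
have invT := trform_inv If.
(* By invariance the cocycle identity for [f] has the Killing term once on the left and twice on the
   right, so it amounts to [bE]. *)
pose f x y : R^o := trform fullv (phi x) (phi y) + b (phi x) (phi y).
have blf : bilin f.
  split=> [y a u v|x a u v]; rewrite /f linearP.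
    by rewrite blT.1 blb.1 scalerDr addrACA.
  by rewrite blT.2 blb.2 scalerDr addrACA.
have bC x y : b x y = - b y x.
  apply/eqP; rewrite -addr_eq0; apply/eqP.
  by have := b0 (x + y); rewrite (bilinDl blb) !(bilinDr blb) !b0 add0r addr0.
have f0 : forall x, f x x = 0.
  apply: (min_nonsolvable_cocycle mM blf) => x y z; rewrite /f !phiM.
  rewrite -(invT (phi x)) -(invT (phi y)) (lieC (phi y) (phi x)) (bilinNl blT).
  rewrite (bC (phi x)) (bC (phi y)) (lieC (phi x) (phi z)) (bilinNl blb) bE; ring.
have T0 x : trform fullv (phi x) (phi x) = 0.
  by have := f0 x; rewrite /f b0 addr0.
have TT0 x y : trform fullv (phi x) (phi y) = 0.
  have := T0 (x + y); rewrite linearD (bilinDl blT) !(bilinDr blT) !T0 add0r addr0.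
  rewrite (symT (phi y)) => /eqP; rewrite -mulr2n -mulr_natr mulf_eq0 pnatr_eq0 orbF.
  by move=> /eqP.
apply: (@min_nonsolvable_not_nil _ _ mM 0%VS).
- by apply/idealP => x y; rewrite memv0 => /eqP->; rewrite lie0r mem0v.
- by move=> E; apply: mM.1; exists 0.
- move=> x; have [|||k xk] := @cartan_nilpotent _ M _ (admx (fullv : {vspace L}) \o phi) _ _ x.
  + by move=> u v /=; rewrite phiM admx_lie.
  + exact: TT0.
  + by rewrite min_nonsolvable_perfect ?memvf.
  exists k => y; rewrite memv0; apply/eqP/phi_inj; rewrite linear0.
  rewrite -(admx_nil If xk (memvf (phi y))).
  by elim: {xk} k => //= k IH; rewrite phiM IH.
Qed.

(** * The Killing 3-form and low-degree differentials *)

Section KillingForm.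
Variables (F : fieldType) (L : lieAlgType F).
Let If : ideal (fullv : {vspace L}). Proof. exact: subvf. Qed.
Local Notation K := (trform (fullv : {vspace L})).
Local Notation i1 := (lift ord0 ord0 : 'I_3).
Local Notation i2 := (lift ord0 (lift ord0 ord0) : 'I_3).
Let blK := trform_bilin (fullv : {vspace L}).
Let invK := trform_inv If.

Definition killing3_fun (x : 'I_3 -> L) : F^o := K (lie (x ord0) (x i1)) (x i2).

Let K0 x y : K (lie x y) y = 0.
Proof. by rewrite invK liexx (bilin0r blK). Qed.

Let K0' x y : K (lie x y) x = 0.
Proof. by rewrite lieC (bilinNl blK) K0 oppr0. Qed.

Fact killing3_is_alt : killing3_fun \in @is_altform F L 3.
Proof.
apply/is_altformP; split=> [x i a u v|x i j].
  rewrite /killing3_fun; case: (unliftP ord0 i) => [i'|] ->.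
    case: (unliftP ord0 i') => [i''|] ->.
      by rewrite !ord1 !upd_same !upd_diff // blK.2.
    by rewrite !upd_same !upd_diff // lie_linearr blK.1.
  by rewrite !upd_same !upd_diff // lie_linearl blK.1.
rewrite /killing3_fun; case: (unliftP ord0 i) => [i'|] ->; case: (unliftP ord0 j) => [j'|] ->.
- case: (unliftP ord0 i') => [i''|] ->; case: (unliftP ord0 j') => [j''|] ->;
    rewrite ?ord1 ?eqxx //.
    by move=> _ ->; exact: K0.
  by move=> _ <-; exact: K0.
- case: (unliftP ord0 i') => [i''|] -> _; rewrite ?ord1 => ->; first exact: K0'.
  by rewrite liexx (bilin0l blK).
- case: (unliftP ord0 j') => [j''|] -> _; rewrite ?ord1 => ->; first exact: K0'.
  by rewrite liexx (bilin0l blK).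
- by rewrite eqxx.
Qed.

Definition killing3 : altform L 3 := AltForm killing3_is_alt.

Lemma diff1E (f : altform L 1) x : diff f x = - f (fun=> lie (x ord0) (x (lift ord0 ord0))).
Proof.
rewrite [x in LHS]fcons_eta -[LHS]/(Defs.contract (x ord0) (diff f) _) cartan altformD altformN.
rewrite diff0E altform0 subr0 /= /lieder_fun big_ord1; congr (- f _).
by apply/funext => h; rewrite [h](ord1 h : h = ord0) upd_same.
Qed.

Definition form2 (f : altform L 2) (a b : L) : F^o := f (fcons a (fun=> b)).

Lemma form2E (f : altform L 2) x : f x = form2 f (x ord0) (x (lift ord0 ord0)).
Proof.
rewrite {1}(fcons_eta x); congr (f (fcons _ _)); apply/funext => h.
by rewrite [h](ord1 h : h = ord0).
Qed.

Lemma form2_bilin f : bilin (form2 f).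
Proof.
split=> [y a u v|x a u v].
  by have := altfun_ml f (fcons 0 (fun=> y)) ord0 a u v; rewrite /= !upd_fcons0.
have := altfun_ml f (fcons x (fun=> 0)) (lift ord0 ord0) a u v.
rewrite /= !upd_fconsS /form2.
have E w : upd (fun=> 0) ord0 w = (fun _ : 'I_1 => w).
  by apply/funext => h; rewrite [h](ord1 h : h = ord0) upd_same.
by rewrite !E.
Qed.

Lemma form2xx f x : form2 f x x = 0.
Proof.
by apply: (altfun_alt f (i := ord0) (j := lift ord0 ord0)); rewrite // fconsS fcons0.
Qed.

Lemma diff2E (f : altform L 2) x : diff f x =
  - (form2 f (lie (x ord0) (x i1)) (x i2) + form2 f (lie (x i1) (x i2)) (x ord0)
     + form2 f (lie (x i2) (x ord0)) (x i1)).
Proof.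
have C a b : form2 f a b = - form2 f b a.
  apply/eqP; rewrite -addr_eq0; apply/eqP; have blf := form2_bilin f.
  by have := form2xx f (a + b); rewrite (bilinDl blf) !(bilinDr blf) !form2xx add0r addr0.
rewrite [x in LHS]fcons_eta -[LHS]/(Defs.contract (x ord0) (diff f) _) cartan altformD altformN.
rewrite diff1E opprK /= /lieder_fun big_ord_recl big_ord1 !form2E /=.
rewrite !upd_same !upd_diff // /contract_fun form2E fcons0 fconsS.
rewrite (C (x ord0)) (lieC (x ord0) (x i2)) (C (x i1)) (bilinNl (form2_bilin f)).
ring.
Qed.

(** By Cartan's formula: the Lie derivative of the form along [A] is 0 by invariance, and its
    contraction with [A] is, up to sign, the differential of the 1-form trform A. *)
Lemma killing3_closed : diff killing3 = 0.
Proof.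
apply: Defs.contract_inj => A; rewrite linear0 cartan.
have -> : lieder A killing3 = 0.
  apply: altform_ext => y; rewrite altform0 /= /lieder_fun !big_ord_recl big_ord0.
  rewrite /killing3_fun !upd_same !upd_diff // addr0 addrA -(bilinDl blK) -lie_jacobi.
  rewrite (lieC A (lie _ _)) (bilinNl blK) invK addNr oppr0.
  by [].
pose lam_fun (x : 'I_1 -> L) : F^o := K A (x ord0).
have lam_alt : lam_fun \in @is_altform F L 1.
  apply/is_altformP; split=> [x i a u v|x i j]; last by rewrite !ord1 eqxx.
  by rewrite /lam_fun ord1 !upd_same blK.2.
have -> : Defs.contract A killing3 = - diff (AltForm lam_alt).
  apply: altform_ext => x; rewrite altformN diff1E opprK /= /contract_fun /killing3_fun.
  by rewrite !fconsS fcons0 invK.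
by rewrite linearN /= diff_diff oppr0 subr0.
Qed.

End KillingForm.

Lemma betti_eq0P (F : fieldType) (L : lieAlgType F) k : betti L k = 0%N <->
  forall f : altform L k, diff f = 0 -> f \in coboundaries L k.
Proof.
split=> [b0 f /cocyclesP fZ|H].
  have : coho_class (Subvs fZ) \in ({: coho L k})%VS by exact: memvf.
  move/eqP: b0; rewrite /betti dimv_eq0 => /eqP->.
  by rewrite memv0 coho_class_eq0.
apply/eqP; rewrite /betti dimv_eq0 -subv0; apply/subvP => q _; rewrite memv0.
rewrite -(vreprK q) -[vproj _ _]/(coho_class _) coho_class_eq0.
by apply/H/cocyclesP/subvsP.
Qed.

Theorem betti3_solvable (R : rcfType) (L : lieAlgType R) : betti L 3 = 0%N -> lie_solvable L.
Proof.
move=> /betti_eq0P/(_ _ (killing3_closed L))/coboundariesP[g gE].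
have [n Ln] : solvable (fullv : {vspace L}); last by exists n.
have blg := form2_bilin g.
(* The sign undoes the one in [diff2E]. *)
apply: (@killing_not_exact _ _ (fun x y => - form2 g x y)).
- split=> [y a u v|x a u v].
    by rewrite /= blg.1 opprD scalerN.
  by rewrite /= blg.2 opprD scalerN.
- by move=> x; rewrite form2xx oppr0.
move=> x y z; pose w := fcons x (fcons y (fun _ : 'I_1 => z)).
have := congr1 (fun h : altform L 3 => h w) gE; rewrite diff2E /= /killing3_fun.
by rewrite /w !fconsS !fcons0 !opprD.
Qed.

(** * Codimension one ideals *)

Local Notation contract := Defs.contract.
Local Notation restrict := Defs.restrict.

(* For the bracket [x, y] = lam x * y - lam y * x the differential of a k-form
   pulled back from ker lam is, up to sign, k times its wedge product with lam. *)
Section Twisted.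
Variables (F : fieldType) (V : vectType F) (lam : {linear V -> F^o}).

Definition twisted of {linear V -> F^o} : Type := V.
Local Notation T := (twisted lam).
HB.instance Definition _ := Vector.on T.

Definition twisted_lie (x y : T) : T := (lam x : F) *: y - (lam y : F) *: x.

Fact twisted_linearl y : linear (twisted_lie^~ y).
Proof.
move=> a u v; rewrite /twisted_lie !linearP /=; apply: vect_ext => i.
by rewrite !(coordD, coordN, coordZ) /GRing.scale /=; ring.
Qed.
Fact twisted_linearr x : linear (twisted_lie x).
Proof.
move=> a u v; rewrite /twisted_lie !linearP /=; apply: vect_ext => i.
by rewrite !(coordD, coordN, coordZ) /GRing.scale /=; ring.
Qed.
Fact twisted_liexx x : twisted_lie x x = 0.
Proof. exact: subrr. Qed.
Fact twisted_jacobi x y z :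
  twisted_lie x (twisted_lie y z) + twisted_lie y (twisted_lie z x) +
  twisted_lie z (twisted_lie x y) = 0.
Proof.
have lam0 u v : lam (twisted_lie u v) = 0.
  have lamZ (a : F) w : lam (a *: w) = a * lam w by exact: linearZ.
  by rewrite /twisted_lie linearB /= !lamZ mulrC subrr.
rewrite {1 3 5}/twisted_lie !lam0 !scale0r !subr0; apply: vect_ext => i.
rewrite /twisted_lie !(coordD, coordN, coordZ) linear0; ring.
Qed.
HB.instance Definition _ := Vector_isLie.Build F T
  twisted_linearl twisted_linearr twisted_liexx twisted_jacobi.

End Twisted.

Lemma contractZl (F : fieldType) (L : lieAlgType F) a (X : L) k (f : altform L k.+1) :
  contract (a *: X) f = a *: contract X f.
Proof.
apply: altform_ext => y; rewrite altformZ /= /contract_fun.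
have f0 : f (fcons 0 y) = 0.
  have := altfun_ml f (fcons 0 y) ord0 (-1) 0 0.
  by rewrite /= !upd_fcons0 scaler0 addr0 scaleN1r addNr.
have := altfun_ml f (fcons 0 y) ord0 a X 0.
by rewrite /= !upd_fcons0 f0 !addr0.
Qed.

Lemma contract_contractxx (F : fieldType) (L : lieAlgType F) (X : L) k
    (f : altform L k.+2) : contract X (contract X f) = 0.
Proof.
apply: altform_ext => y; apply: (altfun_alt f (i := ord0) (j := lift ord0 ord0)) => //.
by rewrite fconsS !fcons0.
Qed.

Lemma contract_contractC (F : fieldType) (L : lieAlgType F) (X Y : L) k
    (f : altform L k.+2) : contract X (contract Y f) = - contract Y (contract X f).
Proof.
apply/eqP; rewrite -addr_eq0; apply/eqP; have := contract_contractxx (X + Y) f.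
rewrite !contractDl !linearD /= !contract_contractxx add0r addr0 => <-.
by rewrite addrC.
Qed.

Lemma altform_arg0 (F : fieldType) (V : vectType F) k (f : altform V k) x i :
  x i = 0 -> f x = 0.
Proof.
move=> xi0; have := altfun_ml f x i (-1) 0 0.
by rewrite /= scaler0 addr0 scaleN1r addNr -{1}xi0 upd_id.
Qed.

(** * The Gysin sequence of a codimension one ideal *)

Section Hyperplane.
Variables (F : fieldType) (L : lieAlgType F) (K : lieIdeal L) (A : L).
Local Notation sK := (subvs_of K).
Hypothesis pA : projv K A = 0.
Variable lam : {linear L -> F^o}.
Hypotheses (lamA : lam A = 1) (lamK : forall x, x \in (K : {vspace L}) -> lam x = 0).
Hypothesis decK : forall x, x - (lam x : F) *: A \in (K : {vspace L}).
Hypothesis char0 : [pchar F] =i pred0.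

Lemma restrictD k (f g : altform L k) : restrict K (f + g) = restrict K f + restrict K g.
Proof. exact: linearD. Qed.

Lemma restrictE k (f : altform L k) (y : 'I_k -> L) :
  (forall i, y i \in (K : {vspace L})) -> restrict K f = 0 -> f y = 0.
Proof.
move=> yK /(congr1 (fun h : altform sK k => h (fun i => Subvs (yK i)))).
by rewrite altform0 /=.
Qed.

Lemma restrict_contractK k (f : altform L k.+1) X : X \in (K : {vspace L}) ->
  restrict K f = 0 -> restrict K (contract X f) = 0.
Proof.
move=> XK f0; apply: altform_ext => y; rewrite altform0 /= /contract_fun.
apply: restrictE f0 => i; case: (unliftP ord0 i) => [j|] ->; rewrite ?fcons0 //.
by rewrite fconsS; exact: subvsP.
Qed.

(** Uniqueness of the components of a form a + A* /\ b. *)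
Lemma form_eq0 k (f : altform L k.+1) :
  restrict K f = 0 -> restrict K (contract A f) = 0 -> f = 0.
Proof.
elim: k f => [|k IH] f f0 fA0; apply: Defs.contract_inj => X; rewrite linear0.
  have : restrict K (contract X f) = 0.
    rewrite -(subrK ((lam X : F) *: A) X) contractDl contractZl restrictD.
    rewrite restrict_contractK // add0r /restrict linearZ /=.
    by rewrite -/(restrict K _) fA0 scaler0.
  by move=> H; apply: altform_ext => y; apply: restrictE H => -[].
have cX Y : Y \in (K : {vspace L}) -> contract Y f = 0.
  move=> YK; apply: IH; first exact: restrict_contractK.
  by rewrite contract_contractC /restrict linearN /= -/(restrict K _) restrict_contractK ?oppr0.
rewrite -(subrK ((lam X : F) *: A) X) contractDl contractZl cX // add0r.
rewrite (_ : contract A f = 0) ?scaler0 //; apply: IH => //.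
by rewrite contract_contractxx /restrict linear0.
Qed.

(** The form A* /\ b, built from the twisted differential instead of a wedge product. The twisted
    bracket is 0 on [K] and [A, x] = x for [x] in [K], and the extension of [b] is killed by
    contraction with [A]. So by Cartan's formula contracting its differential with [A] gives -(k +
    1) b on [K], and characteristic 0 allows the division. *)
Lemma form_exists k (b : altform sK k.+1) : exists f : altform L k.+2,
  restrict K f = 0 /\ restrict K (contract A f) = b.
Proof.
pose T := twisted lam; pose f0 : altform T k.+1 := extend b.
pose c : F := - k.+1%:R^-1.
have kn0 : k.+1%:R != 0 :> F by rewrite ((pcharf0P F).1 char0).
have tw0 x y : x \in (K : {vspace L}) -> y \in (K : {vspace L}) ->
    lie (x : T) (y : T) = 0.
  by move=> xK yK; rewrite /lie /= /twisted_lie !lamK // !scale0r subrr.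
have twA x : x \in (K : {vspace L}) -> lie (A : T) (x : T) = x.
  by move=> xK; rewrite /lie /= /twisted_lie lamA lamK // scale1r scale0r subr0.
have pA' : vsproj K A = 0 by apply: val_inj; rewrite /= unlock.
have iA : @contract F T A k f0 = 0.
  apply: altform_ext => y; rewrite altform0.
  by apply: (altform_arg0 b (i := ord0)); rewrite /= fcons0.
pose d : altform L k.+2 := diff f0.
exists (c *: d); split.
  rewrite /restrict linearZ /=; apply: altform_ext => y.
  rewrite altformZ altform0 [X in _ *: X](_ : _ = 0) ?scaler0 //.
  rewrite /d /= /diff_fun big1 // => j _; rewrite big1 // => i _.
  rewrite [X in _ *: X](_ : _ = 0) ?scaler0 //.
  apply: (altform_arg0 f0 (i := i)); rewrite upd_same.
  by apply: tw0; exact: subvsP.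
have -> : contract A (c *: d) = c *: contract A d by rewrite linearZ.
rewrite /restrict linearZ /=; apply: altform_ext => y.
rewrite altformZ; have -> : pullback vsval (contract A d) y = (- k.+1%:R) * b y.
  have E : @contract F T A _ (diff f0) = lieder (A : T) f0.
    by rewrite cartan iA linear0 subr0.
  rewrite -[LHS]/((@contract F T A _ (diff f0)) (vsval \o y)) E /= /lieder_fun.
  rewrite (eq_bigr (fun=> b y)) => [|j _].
    by rewrite sumr_const card_ord mulNr mulr_natl.
  rewrite twA ?upd_id; last exact: subvsP.
  rewrite /f0 /=; congr (b _); apply/funext => i /=; exact: vsvalK.
by rewrite /c /GRing.scale /= mulrA mulrNN mulVf // mul1r.
Qed.

Local Notation Z := (cocycles sK).
Local Notation B := (coboundaries sK).

Lemma act_formE X k (f : altform L k.+1) : act_form K X f =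
  restrict K (lieder X f) - diff (restrict K (contract X f)).
Proof. by rewrite /act_form cartan /restrict linearB /= -!/(restrict K _) restrict_diff. Qed.

Lemma restrictN k (f : altform L k) : restrict K (- f) = - restrict K f.
Proof. exact: linearN. Qed.

Lemma act_formD X k (f g : altform L k) :
  act_form K X (f + g) = act_form K X f + act_form K X g.
Proof. by rewrite /act_form linearD [contract X _]linearD restrictD. Qed.

Lemma act_formN X k (f : altform L k) : act_form K X (- f) = - act_form K X f.
Proof. by rewrite /act_form linearN [contract X _]linearN restrictN. Qed.

(** [K] acts by zero already on cocycles, as contraction with a vector of [K] preserves vanishing on
    [K]. Hence invariance is a condition on [A] alone. *)
Lemma act_form_decomp X k (f : altform L k) : restrict K f \in Z k ->
  act_form K X f = (lam X : F) *: act_form K A f.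
Proof.
move=> /cocyclesP fZ; rewrite /act_form -{1}(subrK ((lam X : F) *: A) X).
rewrite contractDl contractZl restrictD restrict_contractK ?restrict_diff //.
by rewrite add0r /restrict linearZ.
Qed.

Lemma coho_act_eq0 X k (f : altform L k) (fZ : restrict K f \in Z k) :
  coho_act X (coho_class (Subvs fZ)) = 0 <-> act_form K X f \in B k.
Proof.
rewrite (coho_actE X (f := Subvs fZ) (f' := f) _ fZ) //.
by split=> [/eqP|H]; [|apply/eqP]; rewrite coho_class_eq0.
Qed.

Lemma coho_rep k (b : coho sK k) : exists (f : altform L k) (fZ : restrict K f \in Z k),
  b = coho_class (Subvs fZ).
Proof.
exists (extend (vsval (vrepr b))), (extend_closed (vrepr b)).
rewrite -[LHS](vreprK b); congr (coho_class _); apply: val_inj => /=.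
by rewrite extendK.
Qed.

Lemma coho_act_linear k : linear (@coho_act F L K A k).
Proof.
move=> a p q; pose u := vrepr p; pose v := vrepr q.
have -> : a *: p + q = coho_class (a *: u + v).
  by rewrite -[p]vreprK -[q]vreprK -linearP.
have cf : restrict K (extend (vsval (a *: u + v))) \in Z k by exact: extend_closed.
rewrite (coho_actE A (f' := extend (vsval (a *: u + v))) _ cf) ?extendK //.
rewrite /coho_act -linearP; congr (coho_class _); apply: val_inj => /=.
rewrite /act_form /extend /restrict !linearD /= !linearZ /=; congr (_ + _).
Qed.

Definition act_surjective k := forall c : altform sK k, c \in Z k ->
  exists f : altform L k, restrict K f \in Z k /\ c - act_form K A f \in B k.

Lemma coho_invariantsP k : coho_invariants K k = [set 0] <->
  forall f : altform L k, restrict K f \in Z k -> act_form K A f \in B k ->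
  restrict K f \in B k.
Proof.
split=> [inv0 f fZ fB|H].
  have : coho_invariants K k (coho_class (Subvs fZ)).
    by move=> X; apply/coho_act_eq0; rewrite act_form_decomp // rpredZ.
  by rewrite inv0 => /eqP; rewrite coho_class_eq0.
apply/seteqP; split=> [b binv|_ -> X] /=.
  have [f [fZ bE]] := coho_rep b; move: (binv A); rewrite bE => /coho_act_eq0 fB.
  by apply/eqP; rewrite coho_class_eq0 /= H.
have r0 : restrict K (0 : altform L k) \in Z k by rewrite /restrict linear0 mem0v.
have c0 : coho_class (Subvs r0) = 0.
  by apply/eqP; rewrite coho_class_eq0 /= /restrict linear0 mem0v.
rewrite -{1}c0; apply/coho_act_eq0.
by rewrite /act_form /restrict !linear0 mem0v.
Qed.

(** The action of [A] is an endomorphism of a finite-dimensional space, so it is onto if and only if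
    its kernel, the space of invariants, is 0. *)
Lemma act_surjectiveP k : act_surjective k <-> coho_invariants K k = [set 0].
Proof.
pose h : {linear coho sK k -> coho sK k} :=
  HB.pack (@coho_act F L K A k) (GRing.isLinear.Build _ _ _ _ _ (@coho_act_linear k)).
have hE b : linfun h b = coho_act A b by rewrite lfunE.
have injE : lker (linfun h) == 0%VS <-> coho_invariants K k = [set 0].
  rewrite coho_invariantsP -subv0; split=> [/subvP ker0 f fZ fB|H].
    have : coho_class (Subvs fZ) \in (0%VS : {vspace coho sK k}).
      by apply: ker0; rewrite memv_ker hE; exact/eqP/coho_act_eq0.
    by rewrite memv0 coho_class_eq0.
  apply/subvP => b; rewrite memv_ker memv0 hE; have [f [fZ ->]] := coho_rep b.
  by move=> /eqP/coho_act_eq0 fB; rewrite coho_class_eq0 H.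
rewrite -injE; split=> [surj|ker0].
  have fullE : limg (linfun h) = fullv.
    apply/eqP; rewrite eqEsubv subvf; apply/subvP => b _.
    have [c [cZ ->]] := coho_rep b; have [f [fZ fB]] := surj _ cZ.
    have -> : coho_class (Subvs cZ) = linfun h (coho_class (Subvs fZ)).
      rewrite hE (coho_actE A (f' := f) _ fZ) //; apply/eqP.
      by rewrite vproj_eq -memv_preim lfunE.
    exact/memv_img/memvf.
  have := limg_ker_dim (linfun h) fullv; rewrite capfv fullE => /eqP.
  by rewrite -[X in _ == X]add0n eqn_add2r dimv_eq0.
move=> c cZ; have [g gE] : exists g, coho_class (Subvs cZ) = linfun h g.
  have : coho_class (Subvs cZ) \in limg (linfun h) by rewrite lker0_limgf ?memvf.
  by move=> /memv_imgP[g _ gE]; exists g.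
have [f [fZ gf]] := coho_rep g; exists f; split=> //.
move/eqP: gE; rewrite gf hE (coho_actE A (f' := f) _ fZ) //.
by rewrite vproj_eq -memv_preim lfunE.
Qed.

(** If A . [f] = 0, say with primitive [g], then f + A* /\ g is closed on [L] and still restricts to
    the restriction of [f]; a primitive on [L] restricts to one on [K]. *)
Lemma betti0_invariants k : betti L k.+2 = 0%N -> coho_invariants K k.+2 = [set 0].
Proof.
move=> /betti_eq0P b0; apply/coho_invariantsP => f fZ /coboundariesP[g gE].
have [n [n0 nA]] := form_exists g.
have rn : restrict K (f + n) = restrict K f by rewrite restrictD n0 addr0.
have [|h hE] := coboundariesP _ (b0 (f + n) _).
  apply: form_eq0; first by rewrite restrict_diff rn; exact/cocyclesP.
  rewrite -/(act_form K A (f + n)) act_formD.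
  by rewrite (act_formE A n) restrict_lieder0 // nA sub0r gE subrr.
by rewrite -rn hE restrict_diff; apply/coboundariesP; exists (restrict K h).
Qed.

(** For a cocycle [c] of [K] the form A* /\ c is closed on [L]. If it equals d g, then [g] restricts
    to a cocycle and A . [g] = [c]. *)
Lemma betti0_surjective k : betti L k.+2 = 0%N -> act_surjective k.+1.
Proof.
move=> /betti_eq0P b0 c /cocyclesP cZ; have [f [f0 fA]] := form_exists c.
have [|g gE] := coboundariesP _ (b0 f _).
  apply: form_eq0; first by rewrite restrict_diff f0 linear0.
  rewrite -/(act_form K A f) act_formE restrict_lieder0 // fA cZ.
  by rewrite subr0.
have gZ : restrict K g \in Z k.+1 by apply/cocyclesP; rewrite -restrict_diff -gE.
exists g; split=> //; rewrite /act_form -gE fA subrr.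
exact: mem0v.
Qed.

(** The restriction of a closed form is invariant, hence exact, so after subtracting an exact form
    it is A* /\ c with [c] closed. By surjectivity [c] is the action of [A] on [h] plus d e, and h -
    A* /\ e is a primitive. *)
Lemma invariants_betti0 k : coho_invariants K k.+2 = [set 0] ->
  coho_invariants K k.+3 = [set 0] -> betti L k.+3 = 0%N.
Proof.
move=> /act_surjectiveP surj inv; apply/betti_eq0P => f fZ.
have rf : restrict K f \in Z k.+3 by apply/cocyclesP; rewrite -restrict_diff fZ /restrict linear0.
have : coho_invariants K k.+3 (coho_class (Subvs rf)).
  by move=> X; apply/coho_act_eq0; rewrite /act_form fZ /restrict !linear0 mem0v.
rewrite inv => /eqP; rewrite coho_class_eq0 => /coboundariesP[g /= gE].
pose f1 := f - diff (extend g).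
have f1Z : diff f1 = 0 by rewrite linearB /= diff_diff fZ subr0.
have f10 : restrict K f1 = 0.
  by rewrite /f1 /restrict linearB /= -!/(restrict K _) restrict_diff extendK gE subrr.
pose c := restrict K (contract A f1).
have cZ : c \in Z k.+2.
  apply/cocyclesP; have := act_formE A f1.
  by rewrite {1}/act_form f1Z /restrict !linear0 -!/(restrict K _) restrict_lieder0 // sub0r
    => /esym/eqP; rewrite oppr_eq0 => /eqP.
have [h [hZ /coboundariesP[e eE]]] := surj c cZ.
have [n [n0 nA]] := form_exists e.
have f1E : f1 = diff (h - n).
  apply/eqP; rewrite -subr_eq0; apply/eqP; apply: form_eq0.
    rewrite /restrict linearB /= -!/(restrict K _) f10 restrict_diff sub0r.
    rewrite /restrict linearB /= -!/(restrict K _) n0 subr0.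
    by move/cocyclesP: hZ => ->; rewrite oppr0.
  have -> : restrict K (contract A (f1 - diff (h - n))) =
      c - (act_form K A h - act_form K A n).
    rewrite -act_formN -act_formD /c /act_form -restrictN -restrictD.
    by congr (restrict K _); exact: linearB.
  rewrite (act_formE A n) restrict_lieder0 // nA sub0r opprK opprD addrA -eE subrr.
  by [].
apply/coboundariesP; exists (h - n + extend g).
by rewrite linearD /= -f1E /f1 subrK.
Qed.

End Hyperplane.

(** * Existence of hyperplanes and the equivalence *)

Lemma hyperplane_form (F : fieldType) (V : vectType F) (K : {vspace V}) :
  \dim {:V} = (\dim K).+1 ->
  exists (A : V) (lam : {linear V -> F^o}), [/\ projv K A = 0, lam A = 1,
    forall x, x \in K -> lam x = 0 & forall x, x - (lam x : F) *: A \in K].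
Proof.
move=> dK; have dC : \dim (K^C)%VS = 1%N by rewrite dimv_compl dK subSnn.
pose A := vpick (K^C)%VS.
have A0 : A != 0 by rewrite vpick0 -dimv_eq0 dC.
have AC : (K^C)%VS = <[A]>%VS.
  by apply/esym/eqP; rewrite eqEdim dC dim_vline A0 -memvE memv_pick.
have pA : projv K A = 0 by apply/eqP; rewrite -memv_ker lker_proj AC memv_line.
pose lam_fun x : F^o := coord [tuple A] ord0 (x - projv K x).
have lam_lin : linear lam_fun.
  by move=> a u v; rewrite /lam_fun linearP opprD addrACA -scalerBr linearP.
pose lam : {linear V -> F^o} :=
  HB.pack lam_fun (GRing.isLinear.Build _ _ _ _ lam_fun lam_lin).
have coordA : coord [tuple A] ord0 A = 1.
  by rewrite (coord_free (X := [tuple A]) ord0 ord0) ?seq1_free.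
exists A, lam; split=> //=.
- by rewrite /lam_fun pA subr0.
- by move=> x xK; rewrite /lam_fun projv_id // subrr linear0.
move=> x; have : x - projv K x \in <[A]>%VS by rewrite -AC memv_projC.
rewrite /lam_fun => /vlineP[a xE]; rewrite xE coordZ coordA mulr1.
by rewrite -xE subKr memv_proj.
Qed.

Lemma hyperplane_exists (F : fieldType) (V : vectType F) (D : {vspace V}) :
  D <> fullv -> exists2 K : {vspace V}, (D <= K)%VS & \dim {:V} = (\dim K).+1.
Proof.
move=> nD; have [K [nK DK Kmax]] := max_vspace (nD : (fun U => U <> fullv) D).
exists K => //; have [v _ vK] := vspace_neq_exists (subvf K) nK.
have Kv : (K + <[v]>)%VS = fullv.
  apply: contrapT => nKv; move: vK; rewrite -(Kmax _ nKv (addvSl _ _)).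
  by rewrite (subvP (addvSr _ _)) ?memv_line.
rewrite -Kv dimv_disjoint_sum ?dim_vline.
  by case: eqP vK => [->|_ _]; rewrite ?mem0v // addn1.
apply/eqP; rewrite -subv0; apply/subvP => w; rewrite memv_cap memv0.
case/andP=> wK /vlineP[a wE]; move: wK; rewrite wE.
have [->|a0] := eqVneq a 0; first by rewrite scale0r.
by rewrite rpredZeq (negbTE a0) (negbTE vK).
Qed.

Lemma betti_dim0 (F : fieldType) (L : lieAlgType F) k : \dim {:L} = 0%N ->
  betti L k.+2 = 0%N.
Proof.
move=> d0; apply/betti_eq0P => f _; suff -> : f = 0 by exact: mem0v.
apply: altform_ext => x; apply: (altform_arg0 f (i := ord0)); apply/eqP.
by have := memvf (x ord0); move/eqP: d0; rewrite dimv_eq0 => /eqP->; rewrite memv0.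
Qed.

Theorem theorem5p3 (R : realType) (g : lieAlgType R) :
  trivial34 g <->
  lie_solvable g /\
  (forall K : lieIdeal g,
     \dim {:g} = (\dim K).+1 ->
     (derived_algebra g <= K)%VS ->
     forall i : nat, (2 <= i <= 4)%N -> coho_invariants K i = [set 0]).
Proof.
have char0 : [pchar R] =i pred0 by exact: Num.Theory.pchar_num.
split=> [[b3 b4]|[[n gn] inv]].
  split=> [|K dK _ i]; first exact: betti3_solvable.
  have [A [lam [pA lamA lamK decK]]] := hyperplane_form dK.
  case: i => [|[|[|[|[|i]]]]] // _.
  (* In degree 2 no Betti number gives injectivity directly; b_3 = 0 gives surjectivity instead. *)
  - apply/(act_surjectiveP decK).
    exact: (betti0_surjective pA lamA lamK decK char0 b3).
  - exact: (betti0_invariants pA lamA lamK decK char0 b3).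
  - exact: (betti0_invariants pA lamA lamK decK char0 b4).
(* The zero algebra has no codimension one ideal and is treated apart. *)
have [d0|d0] := eqVneq (\dim {:g}) 0%N; first by split; exact: betti_dim0.
have [K DK dK] : exists2 K : {vspace g}, (derived_algebra g <= K)%VS &
    \dim {:g} = (\dim K).+1.
  (* If the derived algebra were everything, the derived series would be constant, and solvability
     would give dimension 0. *)
  apply: hyperplane_exists => gE; move/eqP: d0; apply; apply/eqP.
  rewrite dimv_eq0 -gn; apply/eqP; elim: {gn} n => //= n <-.
  by rewrite -[LHS]gE.
have IK x y : y \in K -> lie x y \in K.
  by move=> _; apply: (subvP DK); exact: mem_lie_span (memvf x) (memvf y).
have invK := inv (LieIdeal IK) dK DK.
have [A [lam [pA lamA lamK decK]]] := hyperplane_form (dK : _ = (\dim (LieIdeal IK)).+1).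
(* Degrees 2 and 3 give b_3 = 0, degrees 3 and 4 give b_4 = 0. *)
by split; apply: (invariants_betti0 pA lamA lamK decK char0); apply: invK.
Qed.
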